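(* Fix positive edge activities $\lambda$ and rough hole weights $w$. Let $X_0\sim\pi^{\mathrm B}_{\lambda,w}$, and let $X_1,X_2,\dots$ evolve according to the boosted JSV chain $P^{\mathrm B}_{\mathrm{JSV}}(\lambda,w)$. For every $$S\in\{\mathcal P\}\cup\{\mathcal N(u,v):u\in V_1,\ v\in V_2\},$$ write $p_S:=\pi^{\mathrm B}_{\lambda,w}(S)$. There is a universal constant $C>0$ such that, for every integer $T\ge1$, $$\operatorname{Var}\Bigl[\frac1T\sum_{t=0}^{T-1}\mathbf 1_{\{X_t\in S\}}\Bigr]\le\frac{C\,n^3\log n}{T}\,p_S^2 .$$
   Context: Let $V_1,V_2$ be disjoint sets with $|V_1|=|V_2|=n$. In the complete bipartite graph on $(V_1,V_2)$ let $\mathcal P$ be the set of perfect matchings, let $\mathcal N(u,v)$ (for $(u,v)\in V_1\times V_2$) be the set of matchings with $n-1$ edges whose unmatched vertices (holes) are exactly $u$ and $v$, and let $\Omega=\mathcal P\cup\bigcup_{u,v}\mathcal N(u,v)$. Positive edge activities are a function $\lambda:V_1\times V_2\to(0,\infty)$; put $\lambda(M)=\prod_{e\in M}\lambda(e)$ and $\lambda(S)=\sum_{M\in S}\lambda(M)$ for $S\subseteq\Omega$. Ideal hole weights: $w^*(u,v)=\lambda(\mathcal P)/\lambda(\mathcal N(u,v))$. Positive hole weights $w:V_1\times V_2\to(0,\infty)$ are $c$-rough if $c^{-1}\le w(u,v)/w^*(u,v)\le c$ for all $(u,v)$, and rough if they are $2$-rough. Moves (adjacency $M\sim M'$, symmetric):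 add/delete: $M\in\mathcal P$ and $M\setminus\{(u,v)\}\in\mathcal N(u,v)$ for $(u,v)\in M$ are adjacent; slides: $M\in\mathcal N(u,v)$ is adjacent, for each $(x,y)\in M$, to $M\setminus\{(x,y)\}\cup\{(x,v)\}\in\mathcal N(u,y)$ and to $M\setminus\{(x,y)\}\cup\{(u,y)\}\in\mathcal N(x,v)$. Boosted JSV chain: $\pi^{\mathrm B}_{\lambda,w}$ is the probability distribution on $\Omega$ proportional to $n^2\lambda(M)$ for $M\in\mathcal P$ and to $w(u,v)\lambda(M)$ for $M\in\mathcal N(u,v)$. With $\pi=\pi^{\mathrm B}_{\lambda,w}$, the transition matrix $P^{\mathrm B}_{\mathrm{JSV}}=P^{\mathrm B}_{\mathrm{JSV}}(\lambda,w)$ has $P^{\mathrm B}_{\mathrm{JSV}}(M,M')=\frac1{4n}\min\{1,\pi(M')/\pi(M)\}$ for $M\sim M'$, zero for distinct nonadjacent states, and the remaining probability on the self-loop. It is lazy and reversible with respect to $\pi$.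
   Formalization: The formal theorem assumes n ≥ 2; for n = 1 the bound as written is 0 because log n = 0, while the variance is positive (p_S lies strictly between 0 and 1), and for n = 0 log n is undefined. *)

(* Defs.v *)
From HB Require Import structures.
From mathcomp Require Import all_boot all_order all_algebra.
From mathcomp Require Import all_classical all_reals all_analysis.

Set Implicit Arguments.
Unset Strict Implicit.
Unset Printing Implicit Defensive.

Import Order.TTheory GRing.Theory Num.Theory.

Local Open Scope ring_scope.

(* The two sides of the complete bipartite graph are separate finite types, so
   they are disjoint by construction; an edge is a pair in V1 * V2. *)
Section Matchings.
Variables V1 V2 : finType.
Implicit Types (M : {set V1 * V2}) (u : V1) (v : V2).

Definition is_matching M : bool :=
  [forall e in M, forall f in M, ((e.1 == f.1) || (e.2 == f.2)) ==> (e == f)].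

Definition unmatched1 M : {set V1} := [set u | [forall v, (u, v) \notin M]]%SET.
Definition unmatched2 M : {set V2} := [set v | [forall u, (u, v) \notin M]]%SET.

Definition perfect : {set {set V1 * V2}} :=
  [set M | [&& is_matching M, unmatched1 M == finset.set0
                            & unmatched2 M == finset.set0]]%SET.

Definition near_perfect u v : {set {set V1 * V2}} :=
  [set M | [&& is_matching M, #|M| == #|V1|.-1,
               unmatched1 M == [set u]%SET & unmatched2 M == [set v]%SET]]%SET.

Definition Omega : {set {set V1 * V2}} :=
  (perfect :|: \bigcup_u \bigcup_v near_perfect u v)%SET.

Definition state := {M : {set V1 * V2} | M \in Omega}.

Definition delete_move M M' : bool :=
  (M \in perfect) && [exists e in M, M' == (M :\ e)%SET].

Definition slide_move M M' : bool :=
  [exists u, exists v, (M \in near_perfect u v) &&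
    [exists e in M, (M' == ((e.1, v) |: (M :\ e))%SET)
                 || (M' == ((u, e.2) |: (M :\ e))%SET)]].

Definition adj M M' : bool :=
  [|| delete_move M M', delete_move M' M, slide_move M M' | slide_move M' M].

End Matchings.

Arguments perfect {V1 V2}.
Arguments Omega {V1 V2}.

Section Weights.
Variables (R : realType) (V1 V2 : finType).
Variables (lam : V1 -> V2 -> R) (w : V1 -> V2 -> R).
Implicit Types (M : {set V1 * V2}) (A : {set {set V1 * V2}}) (c : R).

Definition activity M : R := \prod_(e in M) lam e.1 e.2.

Definition set_activity A : R := \sum_(M in A) activity M.

Definition ideal_weight (u : V1) (v : V2) : R :=
  set_activity perfect / set_activity (near_perfect u v).

Definition c_rough c : Prop :=
  forall u v, c^-1 <= w u v / ideal_weight u v <= c.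

Definition rough : Prop := c_rough 2.

(* A near-perfect matching lies in exactly one near_perfect u v, so for M in
   Omega that is not perfect the sum has the single term w u v * activity M. *)
Definition boosted_weight M : R :=
  if M \in perfect then #|V1|%:R ^+ 2 * activity M
  else \sum_u \sum_(v | M \in near_perfect u v) w u v * activity M.

Definition piB M : R :=
  boosted_weight M / \sum_(M' in Omega) boosted_weight M'.

Definition piB_set A : R := \sum_(M in A) piB M.

Definition jsv_move M M' : R :=
  if adj M M' then (4 * #|V1|%:R)^-1 * Num.min 1 (piB M' / piB M) else 0.

Definition jsvB (x y : state V1 V2) : R :=
  if x == y then 1 - \sum_(z : state V1 V2 | z != x) jsv_move (val x) (val z)
  else jsv_move (val x) (val y).

End Weights.

Local Open Scope classical_set_scope.

(* The last clause is the Markov property with conditional probabilities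
   multiplied out, so that null histories need no special treatment. *)
Definition markov_chain (R : realType) (S : finType) (mu : S -> R)
    (K : S -> S -> R) (d : measure_display) (W : measurableType d)
    (Pr : probability W R) (X : nat -> W -> S) : Prop :=
  [/\ forall t x, measurable (X t @^-1` [set x]),
      forall x, Pr (X 0%N @^-1` [set x]) = (mu x)%:E
    & forall (t : nat) (h : nat -> S) (y : S),
        let past := [set om | forall s, (s <= t)%N -> X s om = h s] in
        Pr (past `&` X t.+1 @^-1` [set y]) = (Pr past * (K (h t) y)%:E)%E].

(* Main.v *)
(* By reversibility the variance of the time average is governed by the best
   constant k in <f, g>^2 <= k E(g, g), where f is the centred indicator of S
   and E the Dirichlet form: apply this to g = sum_(i < m) P^i f.  So it
   suffices to bound, for every g, the squared difference of the means of g over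
   perfect matchings and over N(u, v) by O(n^3 log n) E(g, g).

   For independent M in P and M' in N(u, v), flipping the alternating path from u
   to v turns M into a sample of N(u, v).  Instead of unwinding the path from one
   end, delete one of its edges and move both holes outwards: the intermediate
   matchings form a triangular grid, on which a Polya-urn flow has energy
   O(log n).  A weight-preserving injection shows that a near-perfect matching Z
   with holes x, y lies in the grid of (M, M') with probability at most
   4 lam(Z) / lam(N(x, y)) = O(n^2) pi(Z), which turns the grid energy into
   O(n^3) E(g, g).

   A perfect matching is a permutation s of V1 (after identifying V2 with V1),
   and a near-perfect one is a permutation with a marked point x, whose edge
   (x, s x) is deleted. *)
Require Import Defs.
From HB Require Import structures.
From mathcomp Require Import all_boot all_order all_algebra all_fingroup.
From mathcomp Require Import all_classical all_reals all_analysis.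
From mathcomp Require Import ring lra zify.

Set Implicit Arguments.
Unset Strict Implicit.
Unset Printing Implicit Defensive.

Import Order.TTheory GRing.Theory Num.Theory.

Local Open Scope ring_scope.

(** * Exchanging permutations along arcs and orbits *)

Section PermOrbits.
Local Open Scope nat_scope.
Local Open Scope group_scope.
Variable T : finType.
Implicit Types (s t p q : {perm T}) (x z : T).

(** A spectral gap alone would give p_S in place of p_S^2. The square comes from pairing: for the
    centred indicator f of a class S, <f, g> is p_S times the difference between the mean of g over
    S and its overall mean, so a comparison of means that does not involve p_S is enough.

    The grid is there for the logarithm. Along a single path all the flow crosses each of up to n
    moves, which costs a factor n; level m of the grid spreads it over L + 1 - m nodes, and the
    costs add up to a harmonic sum.

    The injection needs a third matching. A node f marked at x is weighed against an auxiliary b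
    with b x = f x; then s + t + b - f is again a sum of two perfect matchings, one of which
    contains (u, v). Two bits make the map invertible, whence the 4.

    Constants: a hole class has mass at least 1 / (6 n^2), a move has rate 1 / (4 n), the Dirichlet
    form carries a half, and there are three kinds of moves, so 144 = 6 * 4 * 2 * 3. Congestion 4
    and H_n <= 3 ln n give 1728 = 144 * 4 * 3. Comparing S with the overall mean through the perfect
    matchings costs 4, summing autocovariances 6. *)

Lemma iter_porbit_inj p x i j :
  i < #|porbit p x| -> j < #|porbit p x| -> iter i p x = iter j p x -> i = j.
Proof.
move=> iL jL; rewrite -(nth_traject p iL) -(nth_traject p jL) => eqij.
by apply/eqP; rewrite -(nth_uniq x _ _ (uniq_traject_porbit p x)) ?size_traject // eqij.
Qed.

Lemma mem_iter_porbit p x i : iter i p x \in porbit p x.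
Proof. by rewrite -permX mem_porbit. Qed.

Lemma porbit_iterP p x z :
  reflect (exists2 i, i < #|porbit p x| & z = iter i p x) (z \in porbit p x).
Proof. by rewrite porbit_traject; apply: trajectP. Qed.

Lemma eq_in_porbit p q x :
  {in porbit q x, p =1 q} -> porbit p x = porbit q x.
Proof.
move=> eqpq.
have eqi i : iter i p x = iter i q x.
  by elim: i => //= i ->; rewrite eqpq // mem_iter_porbit.
apply/setP => z; apply/idP/idP.
  by case/porbit_iterP => i _ ->; rewrite eqi mem_iter_porbit.
by case/porbit_iterP => i _ ->; rewrite -eqi mem_iter_porbit.
Qed.

Lemma porbit_permr p x z : (p z \in porbit p x) = (z \in porbit p x).
Proof. by rewrite -!eq_porbit_mem -(porbit_perm p 1 z) expg1. Qed.

(* The cycle x -> p^m x -> ... -> p x -> x. *)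
Fixpoint arcp p x m : {perm T} :=
  if m is k.+1 then tperm x (iter m p x) * arcp p x k else 1.

Lemma arcpE p x m z : m < #|porbit p x| ->
  arcp p x m z = if z == x then iter m p x
                 else if z \in traject p x m.+1 then p^-1 z else z.
Proof.
elim: m z => [|m IH] z mL.
  by rewrite /= perm1 inE; case: eqP.
have mL' := ltnW mL.
have qNt : iter m.+1 p x \notin traject p x m.+1.
  by apply/negP => /trajectP[i im] /(iter_porbit_inj mL (ltn_trans im mL)) e;
     rewrite e ltnn in im.
have qNx : iter m.+1 p x != x.
  by apply: contraNneq qNt => ->; rewrite inE eqxx.
rewrite [LHS]permM trajectSr mem_rcons in_cons IH //.
case: tpermP => [->|->|].
- by rewrite (negPf qNx) (negPf qNt) eqxx.
- by rewrite (negPf qNx) !eqxx /= permK.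
- by move=> /eqP/negPf -> /eqP/negPf ->.
Qed.

Lemma arcp_start p x m : m < #|porbit p x| -> arcp p x m x = iter m p x.
Proof. by move=> mL; rewrite arcpE // eqxx. Qed.

Lemma arcp_succ p x m k : m < #|porbit p x| -> k < m ->
  arcp p x m (iter k.+1 p x) = iter k p x.
Proof.
move=> mL km; rewrite arcpE // ifN; last first.
  by apply/eqP => /(@iter_porbit_inj p x k.+1 0 (leq_ltn_trans km mL) (leq_ltn_trans (leq0n _) mL)).
by rewrite ifT ?permK //; apply/trajectP; exists k.+1.
Qed.

Lemma arcp_out p x m z : m < #|porbit p x| -> z \notin traject p x m.+1 ->
  arcp p x m z = z.
Proof.
move=> mL zN; rewrite arcpE // (negPf zN) ifN //.
by apply: contraNneq zN => ->; rewrite inE eqxx.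
Qed.

Lemma arcpV_last p x m : m < #|porbit p x| -> (arcp p x m)^-1 (iter m p x) = x.
Proof. by move=> mL; rewrite -(arcp_start mL) permK. Qed.

Lemma arcpV_iter p x m k : m < #|porbit p x| -> k < m ->
  (arcp p x m)^-1 (iter k p x) = iter k.+1 p x.
Proof. by move=> mL km; rewrite -(arcp_succ mL km) permK. Qed.

Lemma arcpV_out p x m z : m < #|porbit p x| -> z \notin traject p x m.+1 ->
  (arcp p x m)^-1 z = z.
Proof. by move=> mL zN; rewrite -{1}(arcp_out mL zN) permK. Qed.

Lemma eq_arcp p q x m :
  (forall j, j <= m -> iter j p x = iter j q x) -> arcp p x m = arcp q x m.
Proof.
elim: m => //= m IH eqpq; congr (_ * _); last by apply: IH => j jm; apply: eqpq; apply: leqW.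
by congr tperm; apply: (eqpq m.+1).
Qed.

(** The recursion of [arcp] moves the far end of the arc; this one moves its start, by conjugating
    the outer transposition past [tperm x (p x)]. The two recursions are the slides of the hole in
    V2 and of the hole in V1. *)
Lemma arcp_step p x m : m.+1 < #|porbit p x| ->
  arcp p x m.+1 = tperm x (p x) * arcp p (p x) m.
Proof.
elim: m => [|m IH] mL; first by rewrite /=.
rewrite [LHS]/= -/(arcp p x m.+1) IH; last exact: ltnW.
rewrite [arcp p (p x) m.+1]/= -iterSr -!iterS !mulgA; congr (_ * _).
set r := iter m.+2 p x.
have xr : x != r.
  by apply/eqP => /(@iter_porbit_inj p x 0 m.+2 (leq_ltn_trans (leq0n _) mL) mL).
have pr : p x != r.
  by apply/eqP => /(@iter_porbit_inj p x 1 m.+2 (leq_ltn_trans (ltn0Sn m.+1) mL) mL).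
have := tpermJ (p x) r (tperm x (p x)).
rewrite tpermR tpermD // conjgE tpermV => <-.
by rewrite -!mulgA tperm2 mulg1.
Qed.

(* The exchanged pair, taken in reverse order, has the same arc at [x]: this is
   what makes the exchange invertible. *)
Lemma arcp_flip s t x m j (e := arcp (s * t^-1) x m) :
  m < #|porbit (s * t^-1) x| -> j <= m ->
  iter j ((e^-1 * t) * (e * s)^-1) x = iter j (s * t^-1) x.
Proof.
move=> mL; elim: j => // j IH jm; rewrite iterS IH; last exact: ltnW.
rewrite invMg !permM arcpV_iter // iterS permM permKV permK.
by rewrite /e arcpV_iter // iterS permM.
Qed.

(** By [arcp_flip] both arcs are initial pieces of the one orbit computed from the common exchanged
    pair. A shared far end then forces equal lengths, since iterates below the orbit size are
    distinct, and equal arcs can be cancelled. *)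
Lemma arcp_inj s1 t1 s2 t2 x m1 m2
    (p1 := s1 * t1^-1) (p2 := s2 * t2^-1) :
  m1 < #|porbit p1 x| -> m2 < #|porbit p2 x| ->
  iter m1 p1 x = iter m2 p2 x ->
  arcp p1 x m1 * s1 = arcp p2 x m2 * s2 ->
  (arcp p1 x m1)^-1 * t1 = (arcp p2 x m2)^-1 * t2 ->
  [/\ m1 = m2, s1 = s2 & t1 = t2].
Proof.
move=> L1 L2 eqa eqs eqt.
have f1 j : j <= m1 -> _ := @arcp_flip s1 t1 x m1 j L1.
have f2 j : j <= m2 -> _ := @arcp_flip s2 t2 x m2 j L2.
rewrite -/p1 -/p2 eqs eqt in f1 f2.
have eqm : m1 = m2.
  case: (ltngtP m1 m2) => // lt12.
    have e1 := f1 _ (leqnn _); rewrite f2 1?ltnW // eqa in e1.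
    have := iter_porbit_inj (ltn_trans lt12 L2) L2 e1 => e; by rewrite e ltnn in lt12.
  have e1 := f2 _ (leqnn _); rewrite f1 1?ltnW // -eqa in e1.
  have := iter_porbit_inj (ltn_trans lt12 L1) L1 e1 => e; by rewrite e ltnn in lt12.
have eqe : arcp p1 x m1 = arcp p2 x m2.
  rewrite -eqm; apply: eq_arcp => j jm.
  by rewrite -f1 // f2 // -eqm.
split=> //.
  by move: eqs; rewrite eqe => /mulgI.
by move: eqt; rewrite eqe => /mulgI.
Qed.

Definition swap_fun s t x z := if z \in porbit (s * t^-1) x then t z else s z.

(** [s] and [t] carry an orbit of [s * t^-1] onto the same set, so using [t] inside and [s] outside
    creates no collision. *)
Lemma swap_inj s t x : injective (swap_fun s t x).
Proof.
have cross z w : z \in porbit (s * t^-1) x -> t z = s w -> w \in porbit (s * t^-1) x.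
  by move=> zO e; rewrite -porbit_permr permM -e permK.
rewrite /swap_fun => z w; case: ifP => zO; case: ifP => wO.
- exact: perm_inj.
- by move/(cross _ _ zO); rewrite wO.
- by move/esym/(cross _ _ wO); rewrite zO.
- exact: perm_inj.
Qed.

Definition swap_perm s t x : {perm T} := perm (@swap_inj s t x).

Lemma swap_permE s t x z :
  swap_perm s t x z = if z \in porbit (s * t^-1) x then t z else s z.
Proof. by rewrite permE. Qed.

Lemma porbit_divC s t x : porbit (t * s^-1) x = porbit (s * t^-1) x.
Proof. by rewrite -[RHS]porbitV invMg invgK. Qed.

(** On this orbit the exchanged pair has quotient [t * s^-1], which walks the same orbit backwards.
    This is what makes the exchange an involution. *)
Lemma porbit_swap s t x :
  porbit (swap_perm s t x * (swap_perm t s x)^-1) x = porbit (s * t^-1) x.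
Proof.
rewrite -[RHS]porbit_divC; apply: eq_in_porbit => z zO.
rewrite permM; apply/(@perm_inj _ (swap_perm t s x)); rewrite permKV.
rewrite !swap_permE porbit_permr zO -porbit_divC zO.
by rewrite permM permKV.
Qed.

Lemma swap_permK s t x : swap_perm (swap_perm s t x) (swap_perm t s x) x = s.
Proof.
apply/permP => z; rewrite swap_permE porbit_swap !swap_permE.
by rewrite (porbit_divC s t); case: (z \in _).
Qed.

Lemma swap_perm_start s t x : swap_perm s t x x = t x.
Proof. by rewrite swap_permE porbit_id. Qed.

(** On the orbit [s (p^-1 z) = t z], so the longest arc replaces [s] by [t] throughout. It
    identifies the last node of the grid with the flip of the whole alternating path. *)
Lemma arcp_full s t x :
  arcp (s * t^-1) x #|porbit (s * t^-1) x|.-1 * s = swap_perm s t x.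
Proof.
set p := s * t^-1.
have L0 : 0 < #|porbit p x| by rewrite lt0n card_porbit_neq0.
have lt : #|porbit p x|.-1 < #|porbit p x| by rewrite prednK.
apply/permP => z; rewrite permM arcpE // swap_permE -/p prednK // -porbit_traject.
case: eqP => [->|_].
  rewrite porbit_id; apply/(@perm_inj _ t^-1); rewrite permK -permM -/p -iterS prednK //.
  exact: iter_porbit.
by case: ifP => // _; rewrite /p invMg invgK permM permKV.
Qed.

End PermOrbits.

Lemma ler_sum_inj (R : numDomainType) (I J : finType) (P : pred I) (Q : pred J)
    (F : I -> R) (G : J -> R) (h : I -> J) :
  (forall j, Q j -> 0 <= G j) -> {in P &, injective h} ->
  (forall i, P i -> Q (h i) /\ F i <= G (h i)) ->
  \sum_(i | P i) F i <= \sum_(j | Q j) G j.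
Proof.
move=> G0 hinj hP; pose A := [set i | P i].
have leA : \sum_(i | P i) F i <= \sum_(j in h @: A) G j.
  rewrite big_imset /=; last by move=> i j; rewrite !inE; exact: hinj.
  rewrite (eq_bigl (fun i => i \in A)); last by move=> i; rewrite inE.
  by apply: ler_sum => i; rewrite inE => /hP[].
apply: le_trans leA _.
rewrite [leRHS](bigID (mem (h @: A))) /=.
rewrite (eq_bigl (fun j => Q j && (j \in h @: A))); last first.
  move=> j; case: imsetP => [[i]|]; rewrite ?andbF // inE => /hP[Qh _] ->.
  by rewrite Qh.
by rewrite lerDl; apply: sumr_ge0 => j /andP[/G0].
Qed.

(** * Weights and congestion *)

Section PermWeights.
Variables (R : realFieldType) (T : finType) (l : T -> T -> R).
Hypothesis l_gt0 : forall x y, 0 < l x y.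
Implicit Types (s t b r : {perm T}) (x y z u v a : T).

Definition pweight s : R := \prod_x l x (s x).
Local Notation W := pweight.

Lemma pweight_gt0 s : 0 < W s.
Proof. by apply: prodr_gt0. Qed.

Lemma pweight_swap s t x : W (swap_perm s t x) * W (swap_perm t s x) = W s * W t.
Proof.
rewrite /W -!big_split /=; apply: eq_bigr => z _.
by rewrite !swap_permE (porbit_divC s t); case: ifP => // _; rewrite mulrC.
Qed.

Lemma pweight_tperm s x z :
  W (tperm x z * s) * (l x (s x) * l z (s z)) = W s * (l x (s z) * l z (s x)).
Proof.
have [->|xz] := eqVneq x z; first by rewrite tperm1 mul1g.
have zx : z != x by rewrite eq_sym.
have WD r : W r = l x (r x) * (l z (r z) * \prod_(y | (y != x) && (y != z)) l y (r y)).
  by rewrite /W (bigD1 x) //= (bigD1 z).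
rewrite !WD !permM tpermL tpermR.
under eq_bigr => y /andP[yx yz] do rewrite permM tpermD 1?eq_sym //.
ring.
Qed.

(** Inside the arc the edges of [s] and [t] merely change owner. Only at its ends does the union
    change: (a, s a) and (x, t x) give way to (x, s a) and (a, t x). *)
Lemma pweight_arc s t x m (p := (s * t^-1)%g) (e := arcp p x m)
    (a := iter m p x) : (m < #|porbit p x|)%N ->
  W (e * s)%g * W (e^-1 * t)%g * (l a (s a) * l x (t x))
  = W s * W t * (l x (s a) * l a (t x)).
Proof.
rewrite {}/e {}/a; elim: m => [|m IH] mL; first by rewrite /= invg1 !mul1g.
have mL' := ltnW mL.
rewrite [arcp _ _ _]/= -/(arcp p x m); set e := arcp p x m in IH *.
set r := iter m.+1 p x; set a := iter m p x in IH *.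
have sr : t r = s a by rewrite /r iterS permM permKV.
have ex : e x = a by apply: arcp_start.
have er : e r = r.
  apply: arcp_out => //; apply/negP => /trajectP[i im].
  by move/(iter_porbit_inj mL (ltn_trans im mL)) => ei; rewrite ei ltnn in im.
(* Conjugation by [e] turns [tperm x r] into [tperm a r], so lengthening the arc multiplies each
   member of the pair by one transposition and [pweight_tperm] applies to both. *)
have -> : (tperm x r * e)^-1%g = (tperm a r * e^-1)%g.
  by rewrite invMg tpermV -ex -{2}er -tpermJ conjgE !mulgA mulgK.
have E1 := pweight_tperm (e * s)%g x r.
have E2 := pweight_tperm (e^-1 * t)%g a r.
rewrite !permM ex er in E1.
have ea' : e^-1%g a = x by rewrite -ex permK.
have er' : e^-1%g r = r by rewrite -{1}er permK.
rewrite !permM ea' er' sr in E2.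
have {}IH := IH mL'.
rewrite -!mulgA.
have [n1 n2 n3] : [/\ l x (s a) != 0, l a (t x) != 0 & l r (s a) != 0].
  by split; rewrite lt0r_neq0.
apply: (mulIf n1); apply: (mulIf n2); apply: (mulIf n3).
transitivity ((W (tperm x r * (e * s))%g * (l x (s a) * l r (s r))) *
  (W (tperm a r * (e^-1 * t))%g * (l a (t x) * l r (s a))) * l x (t x)); first by ring.
rewrite E1 E2.
transitivity ((W (e * s)%g * W (e^-1 * t)%g * (l a (s a) * l x (t x))) *
  l x (s r) * l r (s a) * l r (t x)); first by ring.
rewrite IH; ring.
Qed.

End PermWeights.

Section Congestion.
Variables (R : realFieldType) (T : finType) (l : T -> T -> R).
Hypothesis l_gt0 : forall x y, 0 < l x y.
Implicit Types (s t b r f : {perm T}) (x y z u v a : T).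
Local Notation W := (pweight l).

(* With x_i = p^i u, the alternating path of (s, t) from u visits x_0, s x_0,
   x_1, s x_1, ...; its flip between x_i and s x_(i + m) is [arcp p x_i m * s],
   whose marked point x_i is sent to s x_(i + m). *)
Definition in_grid u s t f x : bool :=
  let p := (s * t^-1)%g in
  [exists i : 'I_#|T|, exists m : 'I_#|T|,
    [&& (i + m < #|porbit p u|)%N, x == iter i p u & f == (arcp p x m * s)%g]].

Lemma porbit_leq (p : {perm T}) u : (#|porbit p u| <= #|T|)%N.
Proof. exact: max_card. Qed.

Lemma in_gridP u s t f x (p := (s * t^-1)%g) :
  reflect (exists i m, [/\ (i + m < #|porbit p u|)%N, x = iter i p u
                         & f = (arcp p x m * s)%g])
          (in_grid u s t f x).
Proof.
apply: (iffP existsP) => [[i /existsP[m /and3P[im /eqP -> /eqP ->]]]|].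
  by exists i, m.
move=> [i [m [im -> ->]]].
have lt := leq_trans im (porbit_leq p u).
exists (Ordinal (leq_ltn_trans (leq_addr m i) lt)).
apply/existsP; exists (Ordinal (leq_ltn_trans (leq_addl i m) lt)).
by rewrite /= im !eqxx.
Qed.

(* The multigraph s + t + b - f is split into two permutations.  In [ph + b] the
   edges (x, f x) and (a, ph a) have to be replaced by (x, ph a) and (a, f x);
   the recolouring depends on whether x and a lie on the same cycle of ph + b. *)
Definition untwist f x s t b : {perm T} * {perm T} :=
  let a := (s^-1)%g (f x) in
  let ph := (s * f^-1 * t)%g in
  let th := (ph * b^-1)%g in
  if a \in porbit th x then
    let d := arcp th x (index a (traject th x #|porbit th x|)) in
    (d^-1 * b, d * ph)%g
  else (swap_perm b ph x, tperm x a * swap_perm ph b x)%g.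

Definition untwist_case f x s t b : bool :=
  let th := (s * f^-1 * t * b^-1)%g in (s^-1)%g (f x) \in porbit th x.

Lemma index_traject (p : {perm T}) x a : a \in porbit p x ->
  let k := index a (traject p x #|porbit p x|) in
  (k < #|porbit p x|)%N /\ iter k p x = a.
Proof.
rewrite porbit_traject => aO k.
have kL : (k < #|porbit p x|)%N by rewrite -(size_traject p x #|_|) index_mem.
by split=> //; rewrite -(nth_traject p kL) nth_index.
Qed.

(** The far end of the arc and the complementary matching [e^-1 * t] can be computed from [s], [t],
    [f], [x] alone. Hence [untwist] can be defined without choosing an arc length. *)
Lemma in_grid_spec u s t f x (p := (s * t^-1)%g) : in_grid u s t f x ->
  exists m, [/\ (m < #|porbit p x|)%N, f = (arcp p x m * s)%g,
    iter m p x = (s^-1)%g (f x) & (s * f^-1 * t = (arcp p x m)^-1 * t)%g].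
Proof.
case/in_gridP => i [m [im ex ef]]; exists m.
have mL : (m < #|porbit p x|)%N.
  rewrite ex -permX porbit_perm; exact: leq_ltn_trans (leq_addl _ _) im.
split=> //.
  by rewrite ef permM arcp_start // permK.
by rewrite ef invMg mulgA mulgV mul1g.
Qed.

(** Traces the edge (u, v) of [t]. An arc starting later than [u] stops before the orbit returns to
    [u], so [ph] keeps the edge; an arc starting at [u] leaves [v] matched to its far end [a]. *)
Lemma in_grid_target u s t f x (v := t u) (ph := (s * f^-1 * t)%g)
    (a := (s^-1)%g (f x)) : in_grid u s t f x ->
  (u = x /\ ph a = v) \/ [/\ u != x, u != a & ph u = v].
Proof.
move=> G; have [m [mL ef ea eph]] := in_grid_spec G.
set p := (s * t^-1)%g in ef ea eph mL; rewrite -/ph -/a in ea eph *.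
have [ux|ux] := eqVneq u x.
  left; split=> //.
  by rewrite eph permM -ea arcpV_last // /v ux.
right; case/in_gridP: G => i [m' [im ex ef']]; rewrite -/p in im ex ef'.
have em : m' = m.
  apply: (iter_porbit_inj (p := p) (x := x)) => //.
    rewrite {1}ex -permX porbit_perm; exact: leq_ltn_trans (leq_addl _ _) im.
  have mL' : (m' < #|porbit p x|)%N.
    rewrite ex -permX porbit_perm; exact: leq_ltn_trans (leq_addl _ _) im.
  by rewrite ea /a ef' permM arcp_start // permK.
rewrite em in im.
have uN : u \notin traject p x m.+1.
  apply/negP => /trajectP[j jm]; rewrite ex -iterD => e.
  have ji : (j + i < #|porbit p u|)%N.
    by apply: leq_ltn_trans im; rewrite addnC leq_add2l -ltnS.
  have := @iter_porbit_inj _ p u 0 (j + i)%N (leq_ltn_trans (leq0n _) ji) ji e.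
  move/esym/eqP; rewrite addn_eq0 => /andP[_ /eqP i0].
  by rewrite ex i0 eqxx in ux.
split=> //.
  by apply: contraNneq uN => ->; rewrite -ea; apply/trajectP; exists m.
by rewrite eph permM arcpV_out.
Qed.

(** One of the outputs sends [a] to [f x], which reveals [a]; undoing the recolouring yields [ph]
    and [b]; finally [f] and [ph] with the common end [a] give back [s] and [t] by [arcp_inj]. The
    case bit tells which recolouring to undo. *)
Lemma untwist_inj u f x s1 t1 b1 s2 t2 b2 :
  in_grid u s1 t1 f x -> in_grid u s2 t2 f x -> b1 x = f x -> b2 x = f x ->
  untwist_case f x s1 t1 b1 = untwist_case f x s2 t2 b2 ->
  untwist f x s1 t1 b1 = untwist f x s2 t2 b2 ->
  [/\ s1 = s2, t1 = t2 & b1 = b2].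
Proof.
move=> G1 G2 b1x b2x.
have [m1 [L1 f1 a1 p1]] := in_grid_spec G1.
have [m2 [L2 f2 a2 p2]] := in_grid_spec G2.
suff H : untwist_case f x s1 t1 b1 = untwist_case f x s2 t2 b2 ->
    untwist f x s1 t1 b1 = untwist f x s2 t2 b2 ->
    [/\ (s1^-1)%g (f x) = (s2^-1)%g (f x),
        (s1 * f^-1 * t1)%g = (s2 * f^-1 * t2)%g & b1 = b2].
  move=> h1 h2; have [ea eph eb] := H h1 h2.
  have [] := @arcp_inj _ s1 t1 s2 t2 x m1 m2 L1 L2.
  - by rewrite a1 a2.
  - by rewrite -f1 -f2.
  - by rewrite -p1 -p2.
  - by [].
rewrite /untwist_case /untwist.
set a := (s1^-1)%g (f x); set a' := (s2^-1)%g (f x).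
set ph := (s1 * f^-1 * t1)%g; set ph' := (s2 * f^-1 * t2)%g.
set th := (ph * b1^-1)%g; set th' := (ph' * b2^-1)%g.
case: ifP => aO; case: ifP => aO' // _ [].
  have [kL ek] := index_traject aO; have [kL' ek'] := index_traject aO'.
  set k := index _ _ in kL ek *; set k' := index _ _ in kL' ek' *.
  move=> e1 e2.
  have eqa : a = a'.
    have : (((arcp th x k)^-1 * b1)^-1 (f x) = ((arcp th' x k')^-1 * b2)^-1 (f x))%g.
      by rewrite e1.
    rewrite !invMg !invgK !permM -{1}b1x -b2x !permK.
    by rewrite !arcp_start // ek ek'.
  have [] := @arcp_inj _ ph b1 ph' b2 x k k' kL kL' _ e2 e1.
    by rewrite -/th -/th' ek ek'.
  by [].
move=> e1 e2.
have eqa : a = a'.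
  have ha : (tperm x a * swap_perm ph b1 x)%g a = f x by rewrite permM tpermR swap_perm_start.
  have ha' : (tperm x a' * swap_perm ph' b2 x)%g a' = f x by rewrite permM tpermR swap_perm_start.
  by rewrite e2 -ha' in ha; apply: perm_inj ha.
rewrite -eqa in e2; move/mulgI: e2 => e2.
split=> //.
  by rewrite -(swap_permK ph b1 x) e2 e1 swap_permK.
by rewrite -(swap_permK b1 ph x) e2 e1 swap_permK.
Qed.

(** The passage from [s, t] to [f, ph] and the recolouring of [ph, b] alter the same four edges in
    opposite directions, so the end factors cancel. *)
Lemma untwist_weight u f x s t b : in_grid u s t f x -> b x = f x ->
  W s * W t * W b = W f * (W (untwist f x s t b).1 * W (untwist f x s t b).2).
Proof.
move=> G bx; have [m [mL ef ea eph]] := in_grid_spec G.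
rewrite /untwist; set a := (s^-1)%g (f x) in ea *.
set ph := (s * f^-1 * t)%g in eph *; set th := (ph * b^-1)%g.
have E1 := pweight_arc l_gt0 mL.
rewrite /= ea -ef -eph in E1.
have sa : s a = f x by rewrite /a permKV.
have pha : ph a = t x by rewrite eph permM -ea arcpV_last.
rewrite sa -pha in E1.
have [n1 n2] : l x (ph a) != 0 /\ l a (f x) != 0 by split; rewrite lt0r_neq0.
have [n3 n4] : l x (f x) != 0 /\ l a (ph a) != 0 by split; rewrite lt0r_neq0.
(* Both recolourings make the same replacement of edges, so the cancellation is carried out once for
   an arbitrary pair [r]. *)
suff E2 : forall r : {perm T} * {perm T},
    W r.1 * W r.2 * (l a (ph a) * l x (f x)) = W b * W ph * (l x (ph a) * l a (f x)) ->
    W s * W t * W b = W f * (W r.1 * W r.2).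
  apply: E2; case: ifP => aO /=.
    have [kL ek] := index_traject aO; set k := index _ _ in kL ek *.
    have := pweight_arc l_gt0 kL; rewrite /= ek bx => H.
    by rewrite mulrC [W _ * W _]mulrC mulrC H [W ph * _]mulrC.
  have := pweight_tperm l (swap_perm ph b x) x a.
  rewrite swap_perm_start bx swap_permE -/th aO => H.
  by rewrite -mulrA [l a (ph a) * _]mulrC H mulrA (pweight_swap l b ph x).
move=> r E2.
apply: (mulIf n1); apply: (mulIf n2); apply: (mulIf n3); apply: (mulIf n4).
transitivity ((W s * W t * (l x (f x) * l a (ph a))) * W b
  * (l x (ph a) * l a (f x))); first by ring.
rewrite -E1.
transitivity (W f * (l a (f x) * l x (ph a))
  * (W b * W ph * (l x (ph a) * l a (f x)))); first by ring.
rewrite -E2; ring.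
Qed.

(** Guarantees that the outputs can be ordered so that the second one contains (u, v): recolouring
    keeps this edge if [ph] has it, and otherwise creates it as (x, ph a) with x = u. *)
Lemma untwist_target u f x s t b : in_grid u s t f x -> b x = f x ->
  ((untwist f x s t b).1 u == t u) || ((untwist f x s t b).2 u == t u).
Proof.
move=> G bx; rewrite /untwist; set a := (s^-1)%g (f x).
set ph := (s * f^-1 * t)%g; set th := (ph * b^-1)%g.
have [[ux pha]|[ux ua phu]] := in_grid_target G.
  rewrite -/ph -/a in pha; rewrite ux in pha *.
  case: ifP => aO /=.
    have [kL ek] := index_traject aO; set k := index _ _ in kL ek *.
    by rewrite [(arcp _ _ _ * _)%g _]permM arcp_start // ek pha eqxx orbT.
  by rewrite [(tperm _ _ * _)%g _]permM tpermL (swap_permE ph b) -/th aO pha eqxx orbT.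
rewrite -/ph -/a in ua phu.
case: ifP => aO /=.
  have [kL ek] := index_traject aO; set k := index _ _ in kL ek *.
  have [/trajectP[j jk eu]|uN] := boolP (u \in traject th x k.+1); last first.
    by rewrite [(arcp _ _ _ * _)%g _]permM arcp_out // phu eqxx orbT.
  have {}jk : (j < k)%N.
    by rewrite ltn_neqAle -ltnS jk andbT; apply: contraNneq ua => jk'; rewrite eu jk' ek.
  have du : (arcp th x k)^-1%g u = th u by rewrite {1}eu arcpV_iter // iterS -eu.
  by rewrite (permM _ b) du (permM ph b^-1) permKV phu eqxx.
rewrite [(tperm _ _ * _)%g _]permM tpermD 1?eq_sym // !swap_permE (porbit_divC ph b) -/th.
by case: ifP => _; rewrite phu eqxx ?orbT.
Qed.

(** The injection is [untwist] on triples (s, t, b). The factor 4 counts two bits: which recolouring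
    was used, and which output contains (u, v) and is therefore placed second. *)
Theorem grid_congestion f x u v :
  (\sum_(q : {perm T} * {perm T} | (q.2 u == v) && in_grid u q.1 q.2 f x) W q.1 * W q.2)
    * (\sum_(b : {perm T} | b x == f x) W b)
  <= 4 * W f * ((\sum_s W s) * (\sum_(t : {perm T} | t u == v) W t)).
Proof.
have -> : 4 * W f * ((\sum_s W s) * (\sum_(t : {perm T} | t u == v) W t)) =
  \sum_(j : (bool * bool) * ({perm T} * {perm T}) | j.2.2 u == v) W f * (W j.2.1 * W j.2.2).
  rewrite -(pair_big predT (fun j : {perm T} * {perm T} => j.2 u == v)
    (fun _ j => W f * (W j.1 * W j.2))) /= sumr_const.
  rewrite -(pair_big predT (fun t : {perm T} => t u == v) (fun s t => W f * (W s * W t))) /=.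
  rewrite card_prod !card_bool -[RHS]mulr_natl -mulrA; congr (_ * _).
  rewrite mulr_suml mulr_sumr; apply: eq_bigr => s _.
  by rewrite -mulr_sumr -mulr_sumr.
rewrite mulr_suml; under eq_bigr do rewrite mulr_sumr.
rewrite pair_big /=.
pose h (i : ({perm T} * {perm T}) * {perm T}) : (bool * bool) * ({perm T} * {perm T}) :=
  let r := untwist f x i.1.1 i.1.2 i.2 in
  let c := r.2 u == v in
  ((untwist_case f x i.1.1 i.1.2 i.2, c), if c then r else (r.2, r.1)).
apply: (@ler_sum_inj _ _ _ _ _ _ _ h).
- by move=> j _; rewrite !mulr_ge0 ?ltW ?pweight_gt0.
- move=> [[s1 t1] b1] [[s2 t2] b2] /=; rewrite !unfold_in /=.
  move=> /andP[/andP[_ G1] /eqP b1x] /andP[/andP[_ G2] /eqP b2x] [ec e1 e2].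
  have eu : untwist f x s1 t1 b1 = untwist f x s2 t2 b2.
    move: e2; rewrite e1; case: (untwist f x s1 t1 b1) => r1 r2.
    by case: (untwist f x s2 t2 b2) => r3 r4; case: ifP => _ [-> ->].
  by have [-> -> ->] := untwist_inj G1 G2 b1x b2x ec eu.
- move=> [[s t] b] /andP[/andP[/= /eqP tv G] /eqP bx]; split.
    have := untwist_target G bx; rewrite tv /h /=.
    by case: ((untwist f x s t b).2 u == v) /idP => //= _; rewrite orbF.
  rewrite (untwist_weight G bx) /h /=.
  by case: ifP => //= _; rewrite [X in _ * X]mulrC.
Qed.

End Congestion.

(** Cauchy-Schwarz without division, so that vanishing coefficients need no separate case. *)
Lemma sqr_sum_le (R : realFieldType) (I : Type) (r : seq I) (P : pred I)
    (d c D : I -> R) :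
  (forall i, P i -> 0 <= c i) -> (forall i, P i -> 0 <= D i) ->
  (forall i, P i -> d i ^+ 2 <= c i * D i) ->
  (\sum_(i <- r | P i) d i) ^+ 2
    <= (\sum_(i <- r | P i) c i) * (\sum_(i <- r | P i) D i).
Proof.
move=> c0 D0 dcD.
suff [] : [/\ 0 <= \sum_(i <- r | P i) c i, 0 <= \sum_(i <- r | P i) D i &
  (\sum_(i <- r | P i) d i) ^+ 2
    <= (\sum_(i <- r | P i) c i) * (\sum_(i <- r | P i) D i)] by [].
elim/big_rec3: _ => [|i s S C Pi [C0 S0 sCS]]; first by rewrite expr0n mul0r.
have := dcD _ Pi; have := c0 _ Pi; have := D0 _ Pi.
move: (c i) (D i) (d i) => c' D' d' D'0 c'0 d'cD.
split; [exact: addr_ge0|exact: addr_ge0|].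
have h : s ^+ 2 * d' ^+ 2 <= C * S * (c' * D').
  by apply: ler_pM => //; exact: sqr_ge0.
(* The cross term, by AM-GM: (2 s d')^2 <= 4 (c' S) (C D') <= (c' S + C D')^2. *)
have k : 2 * (s * d') <= c' * S + C * D'.
  have cS : 0 <= c' * S + C * D' by rewrite addr_ge0 // mulr_ge0.
  have X2 : (2 * (s * d')) ^+ 2 <= (c' * S + C * D') ^+ 2.
    have := sqr_ge0 (c' * S - C * D'); nra.
  rewrite leNgt; apply/negP => lt.
  have : (c' * S + C * D') ^+ 2 < (2 * (s * d')) ^+ 2.
    by rewrite ltr_pXn2r ?nnegrE // (le_trans cS (ltW lt)).
  by rewrite ltNge X2.
rewrite sqrrD; nra.
Qed.

(** * Energy of the triangular grid *)

Section Triangle.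
Variable R : realFieldType.

(* Polya-urn weights: node [a] of level [m + 1] splits its mass among nodes
   [a + 1] and [a] of level [m] so that the uniform law is preserved. *)
Lemma level_step (q : nat) (f g : nat -> R) : (0 < q)%N ->
  ((q.+1%:R)^-1 * \sum_(a < q.+1) f a - q%:R^-1 * \sum_(a < q) g a) ^+ 2
  <= q%:R^-1 * \sum_(a < q) ((g a - f a.+1) ^+ 2 + (g a - f a) ^+ 2).
Proof.
move=> q0; have qn0 : q%:R != 0 :> R by rewrite pnatr_eq0 -lt0n.
have q1n0 : q.+1%:R != 0 :> R by rewrite pnatr_eq0.
have qpos : 0 < q%:R :> R by rewrite ltr0n.
have q1E : q.+1%:R = q%:R + 1 :> R by rewrite -natr1.
pose d (a : 'I_q) := (q%:R * q.+1%:R)^-1 *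
  (a.+1%:R * (g a - f a.+1) + (q%:R - a%:R) * (g a - f a)).
have sumf : \sum_(a < q) (a.+1%:R * f a.+1 + (q%:R - a%:R) * f a)
    = q%:R * \sum_(a < q.+1) f a.
  rewrite big_split /=.
  have -> : \sum_(a < q) a.+1%:R * f a.+1 = \sum_(a < q.+1) a%:R * f a.
    by rewrite big_ord_recl /= mul0r add0r.
  have -> : \sum_(a < q) (q%:R - a%:R) * f a = \sum_(a < q.+1) (q%:R - a%:R) * f a.
    by rewrite big_ord_recr /= subrr mul0r addr0.
  rewrite -big_split mulr_sumr; apply: eq_bigr => a _ /=; ring.
have sumd : \sum_(a < q) d a =
    - (q.+1%:R^-1 * \sum_(a < q.+1) f a - q%:R^-1 * \sum_(a < q) g a).
  rewrite -mulr_sumr.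
  have -> : \sum_(a < q) (a.+1%:R * (g a - f a.+1) + (q%:R - a%:R) * (g a - f a))
    = q.+1%:R * \sum_(a < q) g a - q%:R * \sum_(a < q.+1) f a.
    rewrite -sumf mulr_sumr -sumrB; apply: eq_bigr => a _.
    rewrite -!natr1; ring.
  by field; rewrite qn0 nat1r q1n0.
rewrite -sqrrN -sumd.
have sumc : \sum_(a < q) (q%:R ^- 2) = q%:R^-1 :> R.
  by rewrite sumr_const card_ord -mulr_natl; field.
rewrite -sumc; apply: sqr_sum_le => [a _|a _|a _].
- by rewrite invr_ge0 sqr_ge0.
- by rewrite addr_ge0 // sqr_ge0.
- rewrite /d exprMn exprVn exprMn invfM -mulrA ler_pM2l ?invr_gt0 ?exprn_gt0 //.
  rewrite ler_pdivrMl ?exprn_gt0 ?ltr0n //.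
  have a0 : 0 <= a%:R :> R by rewrite ler0n.
  have aq : a%:R + 1 <= q%:R :> R by rewrite natr1 ler_nat.
  rewrite -natr1 q1E.
  move: (a%:R) (q%:R) (g a - f a.+1) (g a - f a) a0 aq => {}a Q x y a0 aq.
  (* Cauchy-Schwarz for two terms; the sum of squares is then at most (Q + 1)^2 because the product
     (a + 1) (Q - a) is nonnegative. *)
  apply: (@le_trans _ _ (((a + 1) ^+ 2 + (Q - a) ^+ 2) * (x ^+ 2 + y ^+ 2))).
    have := sqr_ge0 ((a + 1) * y - (Q - a) * x); nra.
  apply: ler_wpM2r; first by rewrite addr_ge0 // sqr_ge0.
  have : 0 <= (a + 1) * (Q - a) by apply: mulr_ge0; lra.
  nra.
Qed.

(** [N a m] is the value at the node whose arc starts at step [a] of the path and has length [m];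
    [h0] is the value at the perfect matching, joined by a deletion to every node of level 0. The
    two squares are the slides of the hole in V1 and in V2. *)
Definition triangle_energy (N : nat -> nat -> R) (h0 : R) (L : nat) : R :=
  \sum_(a < L.+1) (h0 - N a 0%N) ^+ 2 +
  \sum_(m < L) \sum_(a < L - m)
    ((N a m.+1 - N a.+1 m) ^+ 2 + (N a m.+1 - N a m) ^+ 2).

(** Telescopes through the level averages [A m]. Passing between two levels costs the reciprocal of
    the smaller size, and reaching level 0 costs 1 / (L + 1), so Cauchy-Schwarz leaves a harmonic
    sum. *)
Lemma triangle_energy_bound (N : nat -> nat -> R) (h0 : R) (L : nat) :
  (h0 - N 0%N L) ^+ 2
    <= (\sum_(i < L.+1) i.+1%:R^-1) * triangle_energy N h0 L.
Proof.
pose A m := (L - m).+1%:R^-1 * \sum_(a < (L - m).+1) N a m.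
have AL : A L = N 0%N L by rewrite /A subnn big_ord1 invr1 mul1r.
(* Index 0 is the step from the perfect matching to level 0; index m + 1 is the step from level m to
   level m + 1. *)
pose d (i : 'I_L.+1) := if unlift ord0 i is Some m then A m - A m.+1 else h0 - A 0%N.
have -> : h0 - N 0%N L = \sum_i d i.
  rewrite big_ord_recl /d unlift_none -AL.
  under eq_bigr do rewrite liftK.
  have -> : \sum_(i < L) (A i - A i.+1) = A 0%N - A L.
    rewrite -(big_mkord xpredT (fun i => A i - A i.+1)).
    under eq_bigr do rewrite -opprB.
    by rewrite sumrN telescope_sumr // opprB.
  by rewrite addrA subrK.
pose c (i : 'I_L.+1) : R := if unlift ord0 i is Some m then (L - m)%:R^-1 else L.+1%:R^-1.
pose D (i : 'I_L.+1) : R := if unlift ord0 i is Some m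
  then \sum_(a < L - m) ((N a m.+1 - N a.+1 m) ^+ 2 + (N a m.+1 - N a m) ^+ 2)
  else \sum_(a < L.+1) (h0 - N a 0%N) ^+ 2.
have -> : triangle_energy N h0 L = \sum_i D i.
  rewrite big_ord_recl /D unlift_none; congr (_ + _).
  by under [RHS]eq_bigr do rewrite liftK.
have -> : \sum_(i < L.+1) i.+1%:R^-1 = \sum_i c i.
  rewrite big_ord_recr big_ord_recl /c unlift_none addrC /=; congr (_ + _).
  under [RHS]eq_bigr do rewrite liftK.
  rewrite (reindex_inj rev_ord_inj) /=; apply: eq_bigr => i _.
  by rewrite subnSK.
have sq0 (I : finType) (F G : I -> R) : 0 <= \sum_i (F i ^+ 2 + G i ^+ 2).
  by apply: sumr_ge0 => i _; rewrite addr_ge0 // sqr_ge0.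
apply: sqr_sum_le => i _; rewrite /c /D /d; case: unliftP => [m _|_].
- by rewrite invr_ge0.
- by rewrite invr_ge0.
- exact: sq0.
- by apply: sumr_ge0 => a _; rewrite sqr_ge0.
- have q0 : (0 < L - m)%N by rewrite subn_gt0.
  have := level_step (fun a => N a m) (fun a => N a m.+1) q0.
  by rewrite /A subnS prednK.
- rewrite /A subn0.
  have -> : h0 - L.+1%:R^-1 * \sum_(a < L.+1) N a 0%N
      = \sum_(a < L.+1) L.+1%:R^-1 * (h0 - N a 0%N).
    by rewrite -mulr_sumr sumrB sumr_const card_ord mulrBr -[h0 *+ _]mulr_natl mulKf ?pnatr_eq0 //.
  have {2}-> : L.+1%:R^-1 = \sum_(a < L.+1) L.+1%:R ^- 2 :> R.
    by rewrite sumr_const card_ord -[RHS]mulr_natl expr2 invfM mulVKf ?pnatr_eq0.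
  apply: sqr_sum_le => a _.
  + by rewrite invr_ge0 sqr_ge0.
  + by rewrite sqr_ge0.
  + by rewrite exprMn exprVn.
Qed.

End Triangle.

(** * A Poincare inequality for permutations *)

Section PermPoincare.
Variables (R : realFieldType) (T : finType) (l : T -> T -> R).
Hypothesis l_gt0 : forall x y, 0 < l x y.
Variables (gP : {perm T} -> R) (gN : {perm T} -> T -> R).
Implicit Types (s t b r f : {perm T}) (x y z u v a : T).
Local Notation W := (pweight l).

Definition delete_grad s x : R := (gP s - gN s x) ^+ 2.
(* The slide moves the hole of V2, resp. of V1. *)
Definition slide2_grad f x z : R := (gN f x - gN (tperm x z * f)%g x) ^+ 2.
Definition slide1_grad f x z : R := (gN f x - gN (tperm x z * f)%g z) ^+ 2.

(** Indexed by all moves, with an indicator for both ends lying in the grid, so that averaging over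
    (s, t) turns indicators into probabilities. *)
Definition grid_energy u s t : R :=
  \sum_x (in_grid u s t s x)%:R * delete_grad s x
  + (\sum_(j : {perm T} * (T * T))
      (in_grid u s t j.1 j.2.1 && in_grid u s t (tperm j.2.1 j.2.2 * j.1)%g j.2.1)%:R
        * slide2_grad j.1 j.2.1 j.2.2
  + \sum_(j : {perm T} * (T * T))
      (in_grid u s t j.1 j.2.1 && in_grid u s t (tperm j.2.1 j.2.2 * j.1)%g j.2.2)%:R
        * slide1_grad j.1 j.2.1 j.2.2).

(** Different edges of the triangle are different moves: below the orbit size, the start and the end
    of an arc determine its coordinates. *)
Lemma triangle_le_grid u s t (p := (s * t^-1)%g) (L := #|porbit p u|.-1)
    (N := fun a m : nat => gN (arcp p (iter a p u) m * s)%g (iter a p u)) :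
  triangle_energy N (gP s) L <= grid_energy u s t.
Proof.
have L1 : L.+1 = #|porbit p u| by rewrite prednK // lt0n card_porbit_neq0.
have node (a m : nat) : (a + m < L.+1)%N ->
    in_grid u s t (arcp p (iter a p u) m * s)%g (iter a p u).
  by move=> am; apply/in_gridP; exists a, m; rewrite -/p -L1.
have Linj i j : (i < L.+1)%N -> (j < L.+1)%N -> iter i p u = iter j p u -> i = j.
  by rewrite L1 => iL jL; exact: iter_porbit_inj.
have arcL (a m : nat) : (a + m < L.+1)%N -> (m < #|porbit p (iter a p u)|)%N.
  by move=> am; rewrite -permX porbit_perm -L1; exact: leq_ltn_trans (leq_addl _ _) am.
have iterA (a m : nat) : iter m p (iter a p u) = iter (a + m) p u by rewrite -iterD addnC.
apply: lerD.
  apply: (@ler_sum_inj _ _ _ _ _ _ _ (fun a : 'I_L.+1 => iter a p u)).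
  - by move=> x _; rewrite mulr_ge0 // sqr_ge0.
  - by move=> a b _ _ /Linj ab; apply/val_inj/ab.
  - move=> [a aL] _; split=> //=.
    by have := node a 0%N; rewrite addn0 /= mul1g /N /= mul1g => -> //; rewrite mul1r.
have widen (m : nat) (F : nat -> R) : \sum_(a < L - m) F a = \sum_(a < L | (a < L - m)%N) F a.
  by rewrite (big_ord_widen _ F (leq_subr m L)).
under eq_bigr => m _ do
  rewrite (widen m (fun a : nat =>
    (N a m.+1 - N a.+1 m) ^+ 2 + (N a m.+1 - N a m) ^+ 2)).
rewrite pair_big_dep /= big_split /= addrC.
apply: lerD.
  pose h (i : 'I_L * 'I_L) := ((arcp p (iter i.2 p u) i.1 * s)%g,
     (iter i.2 p u, iter (i.2 + i.1.+1) p u)).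
  apply: (@ler_sum_inj _ _ _ _ _ _ _ h).
  - by move=> x _; rewrite mulr_ge0 // sqr_ge0.
  - move=> [[m mL] [a aL]] [[m' mL'] [a' aL']]; rewrite !unfold_in /= => ma ma' [_ ea em].
    have {}ea : a = a' :> nat by apply: Linj ea; rewrite ltnS ltnW.
    have {}em : (a + m.+1 = a' + m'.+1)%N.
      by apply: Linj em; rewrite addnS ltnS addnC -ltn_subRL.
    subst a'; move: em => /addnI [em].
    by congr pair; apply/val_inj.
  - move=> [[m mL] [a aL]] /= ma; split=> //; rewrite /h /=.
    have am : (a + m.+1 < L.+1)%N by rewrite addnS ltnS addnC -ltn_subRL.
    have step : (tperm (iter a p u) (iter (a + m.+1) p u) * (arcp p (iter a p u) m * s)
        = arcp p (iter a p u) m.+1 * s)%g.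
      by rewrite mulgA -iterA.
    rewrite /slide2_grad step !node //; last first.
      by apply: ltnW; rewrite -addnS.
    by rewrite mul1r -[leRHS]sqrrN opprB.
pose h (i : 'I_L * 'I_L) := ((arcp p (iter i.2 p u) i.1.+1 * s)%g,
     (iter i.2 p u, iter i.2.+1 p u)).
apply: (@ler_sum_inj _ _ _ _ _ _ _ h).
- by move=> x _; rewrite mulr_ge0 // sqr_ge0.
- move=> [[m mL] [a aL]] [[m' mL'] [a' aL']]; rewrite !unfold_in /= => ma ma' [ef ea _].
  have {}ea : a = a' :> nat by apply: Linj ea; rewrite ltnS ltnW.
  subst a'; have am : (a + m.+1 < L.+1)%N by rewrite addnS ltnS addnC -ltn_subRL.
  have am' : (a + m'.+1 < L.+1)%N by rewrite addnS ltnS addnC -ltn_subRL.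
  have : arcp p (iter a p u) m.+1 (iter a p u) = arcp p (iter a p u) m'.+1 (iter a p u).
    by apply: (@perm_inj _ s); rewrite -!permM; congr (fun_of_perm _ _); exact: ef.
  rewrite !arcp_start ?arcL // !iterA => /Linj.
  move=> /(_ am am') /addnI [em].
  by congr pair; apply/val_inj.
- move=> [[m mL] [a aL]] /= ma; split=> //; rewrite /h.
  have am : (a + m.+1 < L.+1)%N by rewrite addnS ltnS addnC -ltn_subRL.
  have step : (tperm (iter a p u) (iter a.+1 p u) * (arcp p (iter a p u) m.+1 * s)
        = arcp p (iter a.+1 p u) m * s)%g.
    by rewrite arcp_step ?arcL // !mulgA tperm2 mul1g iterS.
  pose F := (arcp p (iter a p u) m.+1 * s)%g.
  pose x := iter a p u; pose z := iter a.+1 p u.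
  rewrite -[leRHS]/((in_grid u s t F x && in_grid u s t (tperm x z * F)%g z)%:R
    * (gN F x - gN (tperm x z * F)%g z) ^+ 2).
  rewrite /F /x /z step !node ?mul1r //.
  by rewrite addSnnS.
Qed.

Lemma pair_gradient u s t :
  (gP s - gN (swap_perm s t u) u) ^+ 2
    <= (\sum_(i < #|T|) i.+1%:R^-1) * grid_energy u s t.
Proof.
pose p := (s * t^-1)%g; pose L := #|porbit p u|.-1.
have L1 : L.+1 = #|porbit p u| by rewrite prednK // lt0n card_porbit_neq0.
have := triangle_energy_bound
  (fun a m : nat => gN (arcp p (iter a p u) m * s)%g (iter a p u)) (gP s) L.
rewrite /= /L arcp_full => /le_trans; apply.
have e0 : 0 <= grid_energy u s t.
  by rewrite !addr_ge0 //; apply: sumr_ge0 => j _; rewrite mulr_ge0 // sqr_ge0.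
apply: (@le_trans _ _ ((\sum_(i < L.+1) i.+1%:R^-1) * grid_energy u s t)).
  apply: ler_wpM2l; last exact: triangle_le_grid.
  by apply: sumr_ge0 => i _; rewrite invr_ge0.
apply: ler_wpM2r => //.
have LT : (L.+1 <= #|T|)%N by rewrite L1; exact: porbit_leq.
rewrite (big_ord_widen _ (fun i => i.+1%:R^-1) LT).
rewrite [leRHS](bigID (fun i : 'I_#|T| => (i < L.+1)%N)) /= lerDl.
by apply: sumr_ge0 => i _; rewrite invr_ge0.
Qed.

Definition perfect_density s : R := W s / \sum_r W r.
(** The law lam(Z) / lam(N(x, f x)) of the near-perfect matching Z: the factor of the deleted edge
    (x, f x) cancels from numerator and denominator. *)
Definition hole_density f x : R := W f / \sum_(b : {perm T} | b x == f x) W b.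

Definition perfect_mean : R := (\sum_s W s)^-1 * \sum_s W s * gP s.
Definition hole_mean u v : R :=
  (\sum_(t : {perm T} | t u == v) W t)^-1 * \sum_(t : {perm T} | t u == v) W t * gN t u.

(** A move is used only if both of its ends are in the grid, so its probability is bounded through
    either end. The resulting minimum has the shape of a Metropolis rate. *)
Definition min_energy : R :=
  \sum_(j : {perm T} * T) Num.min (perfect_density j.1) (hole_density j.1 j.2)
     * delete_grad j.1 j.2
  + (\sum_(j : {perm T} * (T * T))
      Num.min (hole_density j.1 j.2.1) (hole_density (tperm j.2.1 j.2.2 * j.1)%g j.2.1)
        * slide2_grad j.1 j.2.1 j.2.2
  + \sum_(j : {perm T} * (T * T))
      Num.min (hole_density j.1 j.2.1) (hole_density (tperm j.2.1 j.2.2 * j.1)%g j.2.2)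
        * slide1_grad j.1 j.2.1 j.2.2).

Lemma sum_pweight_gt0 u v : 0 < \sum_(t : {perm T} | t u == v) W t.
Proof.
rewrite (bigD1 (tperm u v)) ?tpermL //=.
apply: ltr_pwDl; first exact: pweight_gt0.
by apply: sumr_ge0 => s _; rewrite ltW ?pweight_gt0.
Qed.

Lemma sum_pweight_all_gt0 : 0 < \sum_s W s.
Proof.
rewrite (bigD1 1%g) //=.
apply: ltr_pwDl; first exact: pweight_gt0.
by apply: sumr_ge0 => s _; rewrite ltW ?pweight_gt0.
Qed.

(** Under independent [s] and [t] with [t u = v], the exchange along the orbit of [u] is an
    involution preserving the product weight. Hence [swap_perm s t u] has the law of [t], and the
    two means are coupled by the ends of one grid. *)
Lemma mean_difference u v :
  perfect_mean - hole_mean u v =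
  \sum_(q : {perm T} * {perm T} | q.2 u == v)
    W q.1 * W q.2 / ((\sum_s W s) * \sum_(t : {perm T} | t u == v) W t)
      * (gP q.1 - gN (swap_perm q.1 q.2 u) u).
Proof.
have A0 := lt0r_neq0 sum_pweight_all_gt0; have B0 := lt0r_neq0 (sum_pweight_gt0 u v).
rewrite /perfect_mean /hole_mean.
set A := \sum_s W s in A0 *; set B := \sum_(t : {perm T} | _) W t in B0 *.
have -> : \sum_(q : {perm T} * {perm T} | q.2 u == v) W q.1 * W q.2 / (A * B)
      * (gP q.1 - gN (swap_perm q.1 q.2 u) u) =
   (\sum_(q : {perm T} * {perm T} | q.2 u == v) W q.1 * W q.2 * gP q.1) / (A * B)
   - (\sum_(q : {perm T} * {perm T} | q.2 u == v) W q.1 * W q.2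
        * gN (swap_perm q.1 q.2 u) u) / (A * B).
  by rewrite !mulr_suml -sumrB; apply: eq_bigr => q _; ring.
have -> : \sum_(q : {perm T} * {perm T} | q.2 u == v) W q.1 * W q.2 * gP q.1
    = B * \sum_s W s * gP s.
  rewrite -(pair_big predT (fun t : {perm T} => t u == v) (fun s t => W s * W t * gP s)) /=.
  rewrite mulr_sumr; apply: eq_bigr => s _; rewrite mulr_suml.
  by apply: eq_bigr => t _; ring.
have -> : \sum_(q : {perm T} * {perm T} | q.2 u == v) W q.1 * W q.2
        * gN (swap_perm q.1 q.2 u) u
    = A * \sum_(t : {perm T} | t u == v) W t * gN t u.
  pose h (q : {perm T} * {perm T}) := (swap_perm q.2 q.1 u, swap_perm q.1 q.2 u).
  have hK : involutive h by case=> s t; rewrite /h /= !swap_permK.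
  rewrite (reindex_inj (inv_inj hK)) /=.
  transitivity (\sum_(q : {perm T} * {perm T} | q.2 u == v) W q.1 * W q.2 * gN q.2 u).
    apply: eq_big => [q|q _]; first by rewrite swap_perm_start.
    by rewrite swap_permK pweight_swap [W q.2 * _]mulrC.
  rewrite -(pair_big predT (fun t : {perm T} => t u == v) (fun s t => W s * W t * gN t u)) /=.
  rewrite mulr_suml; apply: eq_bigr => s _; rewrite mulr_sumr.
  by apply: eq_bigr => t _; ring.
by field; rewrite A0 B0.
Qed.

Lemma grid_probability f x u v :
  \sum_(q : {perm T} * {perm T} | q.2 u == v)
    W q.1 * W q.2 / ((\sum_s W s) * \sum_(t : {perm T} | t u == v) W t)
      * (in_grid u q.1 q.2 f x)%:R <= 4 * hole_density f x.
Proof.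
have A0 := sum_pweight_all_gt0; have B0 := sum_pweight_gt0 u v.
have C0 := sum_pweight_gt0 x (f x).
have H := grid_congestion l_gt0 f x u v.
rewrite /hole_density mulrA ler_pdivlMr //.
set A := \sum_s W s in A0 H *; set B := \sum_(t : {perm T} | t u == v) W t in B0 H *.
rewrite -(ler_pM2r (mulr_gt0 A0 B0)). apply: le_trans _ H.
rewrite mulrAC; apply: ler_wpM2r; first exact: ltW.
rewrite mulr_suml [leRHS]big_mkcondr /=; apply: ler_sum => q _.
case: ifP => _; rewrite ?mulr1 ?mulr0 ?mul0r //.
by rewrite divfK // lt0r_neq0 // mulr_gt0.
Qed.

Theorem perm_poincare u v :
  (perfect_mean - hole_mean u v) ^+ 2
    <= (\sum_(i < #|T|) i.+1%:R^-1) * (4 * min_energy).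
Proof.
have A0 := sum_pweight_all_gt0; have B0 := sum_pweight_gt0 u v.
rewrite mean_difference.
have prob := grid_probability _ _ u v.
set A := \sum_s W s in A0 prob *; set B := \sum_(t : {perm T} | t u == v) W t in B0 prob *.
pose pr (q : {perm T} * {perm T}) := W q.1 * W q.2 / (A * B).
have pr0 q : 0 <= pr q by rewrite /pr divr_ge0 ?mulr_ge0 // ltW // ?pweight_gt0.
have sumpr (X : {perm T} -> R) :
    \sum_(q : {perm T} * {perm T} | q.2 u == v) pr q * X q.1 = A^-1 * \sum_s W s * X s.
  rewrite -(pair_big predT (fun t : {perm T} => t u == v)
    (fun s t => W s * W t / (A * B) * X s)) /= [RHS]mulr_sumr.
  apply: eq_bigr => s _; rewrite (eq_bigr (fun t => (A * B)^-1 * W s * X s * W t)).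
    by rewrite -mulr_sumr -/B; field; rewrite !lt0r_neq0.
  by move=> t _; ring.
have pr1 : \sum_(q : {perm T} * {perm T} | q.2 u == v) pr q = 1.
  have := sumpr (fun=> 1); under eq_bigr do rewrite mulr1.
  by move->; under eq_bigr do rewrite mulr1; rewrite mulVf // lt0r_neq0.
set Hn := \sum_(i < #|T|) _.
have Hn0 : 0 <= Hn by apply: sumr_ge0 => i _; rewrite invr_ge0.
apply: (@le_trans _ _ (\sum_(q : {perm T} * {perm T} | q.2 u == v)
   pr q * (gP q.1 - gN (swap_perm q.1 q.2 u) u) ^+ 2)).
  rewrite -[leRHS]mul1r -{1}pr1; apply: sqr_sum_le => q _ //.
    by rewrite mulr_ge0 // sqr_ge0.
  by rewrite exprMn expr2 mulrA.
apply: (@le_trans _ _ (\sum_(q : {perm T} * {perm T} | q.2 u == v)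
   Hn * (pr q * grid_energy u q.1 q.2))).
  apply: ler_sum => q _; rewrite [leRHS]mulrCA; apply: ler_wpM2l => //.
  exact: pair_gradient.
rewrite -mulr_sumr; apply: ler_wpM2l => //.
pose Q := fun q : {perm T} * {perm T} => q.2 u == v.
have swapsum (J : finType) (b : {perm T} * {perm T} -> J -> bool) (G M : J -> R) :
    (forall j, 0 <= G j) ->
    (forall j, \sum_(q | Q q) pr q * (b q j)%:R <= 4 * M j) ->
    \sum_(q | Q q) pr q * (\sum_j (b q j)%:R * G j) <= 4 * \sum_j M j * G j.
  move=> G0 bM; under eq_bigr do rewrite mulr_sumr.
  rewrite exchange_big /= mulr_sumr; apply: ler_sum => j _.
  under eq_bigr do rewrite mulrA.
  by rewrite -mulr_suml [leRHS]mulrA; apply: ler_wpM2r.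
have and_le (b1 b2 : {perm T} * {perm T} -> bool) m1 m2 :
    \sum_(q | Q q) pr q * (b1 q)%:R <= 4 * m1 ->
    \sum_(q | Q q) pr q * (b2 q)%:R <= 4 * m2 ->
    \sum_(q | Q q) pr q * (b1 q && b2 q)%:R <= 4 * Num.min m1 m2.
  move=> h1 h2; rewrite minEle; case: ifP => _.
    apply: le_trans h1; apply: ler_sum => q _; apply: ler_wpM2l => //.
    by case: (b1 q); case: (b2 q).
  apply: le_trans h2; apply: ler_sum => q _; apply: ler_wpM2l => //.
    by case: (b1 q); case: (b2 q).
rewrite /min_energy !mulrDr.
(* The deletions from [q.1] become deletions from every permutation with the indicator [q.1 == j.1],
   so that they too are events on both ends of a fixed move. *)
rewrite (eq_bigr (fun q => pr q * (\sum_(j : {perm T} * T)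
     ((q.1 == j.1) && in_grid u q.1 q.2 j.1 j.2)%:R * delete_grad j.1 j.2) +
  (pr q * (\sum_(j : {perm T} * (T * T))
      (in_grid u q.1 q.2 j.1 j.2.1 && in_grid u q.1 q.2 (tperm j.2.1 j.2.2 * j.1)%g j.2.1)%:R
        * slide2_grad j.1 j.2.1 j.2.2)
  + pr q * (\sum_(j : {perm T} * (T * T))
      (in_grid u q.1 q.2 j.1 j.2.1 && in_grid u q.1 q.2 (tperm j.2.1 j.2.2 * j.1)%g j.2.2)%:R
        * slide1_grad j.1 j.2.1 j.2.2)))); last first.
  move=> q _; rewrite /grid_energy !mulrDr; congr (pr q * _ + _).
  rewrite -(pair_bigA _ (fun s x => ((q.1 == s) && in_grid u q.1 q.2 s x)%:R * delete_grad s x)) /=.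
  rewrite [RHS](bigD1 q.1) //= [X in _ + X]big1 ?addr0 => [|s].
    by apply: eq_bigr => x _; rewrite eqxx.
  by rewrite eq_sym => /negPf sq; apply: big1 => x _; rewrite sq mul0r.
rewrite !big_split /=; apply: lerD; last apply: lerD.
- apply: (swapsum _ (fun q j => (q.1 == j.1) && in_grid u q.1 q.2 j.1 j.2)) => [j|j].
    exact: sqr_ge0.
  apply: (and_le (fun q => q.1 == j.1) (fun q => in_grid u q.1 q.2 j.1 j.2)); last exact: prob.
  rewrite (sumpr (fun s => (s == j.1)%:R)) (bigD1 j.1) //= eqxx mulr1 big1 ?addr0.
    rewrite mulrC -/(perfect_density j.1) ler_peMl ?ler1n //.
    by rewrite divr_ge0 // ltW // pweight_gt0.
  by move=> s /negPf ->; rewrite mulr0.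
- apply: (swapsum _ (fun q (j : {perm T} * (T * T)) => in_grid u q.1 q.2 j.1 j.2.1 && _)) => [j|j].
    exact: sqr_ge0.
  by apply: (and_le (fun q => in_grid u q.1 q.2 _ _) (fun q => in_grid u q.1 q.2 _ _)); exact: prob.
- apply: (swapsum _ (fun q (j : {perm T} * (T * T)) => in_grid u q.1 q.2 j.1 j.2.1 && _)) => [j|j].
    exact: sqr_ge0.
  by apply: (and_le (fun q => in_grid u q.1 q.2 _ _) (fun q => in_grid u q.1 q.2 _ _)); exact: prob.
Qed.

End PermPoincare.

(** * Time averages of a reversible chain *)

Section ReversibleChain.
Variables (R : realFieldType) (S : finType) (mu : S -> R) (K : S -> S -> R).
Hypothesis mu_ge0 : forall x, 0 <= mu x.
Hypothesis K_ge0 : forall x y, 0 <= K x y.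
Hypothesis K_sum1 : forall x, \sum_y K x y = 1.
Hypothesis K_rev : forall x y, mu x * K x y = mu y * K y x.
Implicit Types (f g h : S -> R).

Definition mudot g h : R := \sum_x mu x * (g x * h x).
Definition kernel_op g : S -> R := fun x => \sum_y K x y * g y.
Definition dirichlet g : R := 2^-1 * \sum_x \sum_y mu x * K x y * (g x - g y) ^+ 2.

Lemma mudotC g h : mudot g h = mudot h g.
Proof. by apply: eq_bigr => x _; rewrite [g x * _]mulrC. Qed.

Lemma mudot_opE g h : mudot g (kernel_op h) = \sum_x \sum_y mu x * K x y * (g x * h y).
Proof.
apply: eq_bigr => x _; rewrite !mulr_sumr; apply: eq_bigr => y _; ring.
Qed.

Lemma mudot_op_sym g h : mudot (kernel_op g) h = mudot g (kernel_op h).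
Proof.
rewrite mudotC !mudot_opE exchange_big; apply: eq_bigr => x _; apply: eq_bigr => y _.
by rewrite K_rev [h y * _]mulrC.
Qed.

Lemma mudot_diagl g : \sum_x \sum_y mu x * K x y * g x = \sum_x mu x * g x.
Proof.
apply: eq_bigr => x _; rewrite -mulr_suml -mulr_sumr K_sum1 mulr1 //.
Qed.

Lemma mudot_diagr g : \sum_x \sum_y mu x * K x y * g y = \sum_x mu x * g x.
Proof.
rewrite exchange_big -mudot_diagl; apply: eq_bigr => x _; apply: eq_bigr => y _.
by rewrite K_rev.
Qed.

Lemma dirichletE g : dirichlet g = mudot g g - mudot g (kernel_op g).
Proof.
rewrite /dirichlet mudot_opE.
have -> : \sum_x \sum_y mu x * K x y * (g x - g y) ^+ 2 =
   \sum_x \sum_y mu x * K x y * (g x * g x) + \sum_x \sum_y mu x * K x y * (g y * g y)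
   - 2 * \sum_x \sum_y mu x * K x y * (g x * g y).
  rewrite mulr_sumr -big_split -sumrB; apply: eq_bigr => x _ /=.
  rewrite mulr_sumr -big_split -sumrB; apply: eq_bigr => y _ /=; ring.
rewrite (mudot_diagl (fun x => g x * g x)) (mudot_diagr (fun x => g x * g x)) /mudot.
by field.
Qed.

(** The kernel has no eigenvalue below -1: the left side is the Dirichlet form with g x + g y in
    place of g x - g y. *)
Lemma mudot_add_op_ge0 g : 0 <= mudot g g + mudot g (kernel_op g).
Proof.
have -> : mudot g g + mudot g (kernel_op g) =
   2^-1 * \sum_x \sum_y mu x * K x y * (g x + g y) ^+ 2.
  rewrite mudot_opE.
  have -> : \sum_x \sum_y mu x * K x y * (g x + g y) ^+ 2 =
     \sum_x \sum_y mu x * K x y * (g x * g x) + \sum_x \sum_y mu x * K x y * (g y * g y)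
     + 2 * \sum_x \sum_y mu x * K x y * (g x * g y).
    rewrite mulr_sumr -!big_split; apply: eq_bigr => x _ /=.
    rewrite mulr_sumr -!big_split; apply: eq_bigr => y _ /=; ring.
  rewrite (mudot_diagl (fun x => g x * g x)) (mudot_diagr (fun x => g x * g x)) /mudot.
  by field.
rewrite mulr_ge0 ?invr_ge0 //; apply: sumr_ge0 => x _; apply: sumr_ge0 => y _.
by rewrite mulr_ge0 ?sqr_ge0 // mulr_ge0.
Qed.

Lemma mudot_op_contract g : mudot (kernel_op g) (kernel_op g) <= mudot g g.
Proof.
rewrite /mudot -(mudot_diagr (fun x => g x * g x)); apply: ler_sum => x _.
under [leRHS]eq_bigr do rewrite -mulrA.
rewrite -mulr_sumr; apply: ler_wpM2l => //.
rewrite -expr2 -[leRHS]mul1r -{1}(K_sum1 x); apply: sqr_sum_le => y _ //.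
  by rewrite mulr_ge0 // -expr2 sqr_ge0.
by rewrite exprMn !expr2 -mulrA.
Qed.

Variables (f : S -> R) (kappa : R).
Hypothesis kappa_ge0 : 0 <= kappa.
Hypothesis f_poincare : forall g, mudot f g ^+ 2 <= kappa * dirichlet g.

Definition autocov k : R := mudot f (iter k kernel_op f).
Local Notation c := autocov.

Lemma mudot_iter j k : mudot (iter j kernel_op f) (iter k kernel_op f) = c (j + k).
Proof.
elim: j k => // j IH k.
by rewrite iterS mudot_op_sym -iterS IH addSnnS.
Qed.

Lemma autocov_even_ge0 m : 0 <= c (m + m).
Proof.
by rewrite -mudot_iter; apply: sumr_ge0 => x _; rewrite mulr_ge0 // -expr2 sqr_ge0.
Qed.

(* Pairing an even lag with the next odd one absorbs negative eigenvalues. *)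
Lemma autocov_pair_ge0 m : 0 <= c (m + m) + c (m + m).+1.
Proof. by have := mudot_add_op_ge0 (iter m kernel_op f); rewrite -iterS !mudot_iter addnS. Qed.

(** Testing the inequality on [f] itself gives c(0)^2 <= kappa (c(0) - c(1)), and c(1) >= -c(0). *)
Lemma autocov0_le : c 0 <= 2 * kappa.
Proof.
have c0 : 0 <= c 0 := autocov_even_ge0 0.
have h := f_poincare f; have p := autocov_pair_ge0 0.
have d : dirichlet f = c 0 - c 1 by rewrite dirichletE.
rewrite -/(c 0) d /= in h p.
have h2 : c 0 * c 0 <= (2 * kappa) * c 0.
  rewrite -expr2; apply: le_trans h _.
  by rewrite [2 * _]mulrC -mulrA; apply: ler_wpM2l => //; lra.
move: c0; rewrite le_eqVlt => /predU1P[<-|c0]; first by rewrite mulr_ge0.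
by rewrite ler_pM2r in h2.
Qed.

Lemma autocov_even_le m : c (m + m) <= c 0.
Proof.
elim: m => // m; apply: le_trans.
by rewrite -!mudot_iter iterS; exact: mudot_op_contract.
Qed.

Lemma sum_autocov_ge0 m n : 0 <= \sum_(k < n + n) c (m + m + k).
Proof.
elim: n => [|n IH]; first by rewrite big_ord0.
rewrite addSn addnS !big_ord_recr /= -addrA; apply: addr_ge0 => //.
have := autocov_pair_ge0 (m + n); congr (_ <= _); congr (c _ + c _); lia.
Qed.

Lemma mudot_suml n h : mudot (fun x => \sum_(k < n) iter k kernel_op f x) h
  = \sum_(k < n) mudot (iter k kernel_op f) h.
Proof.
rewrite exchange_big; apply: eq_bigr => x _ /=.
by rewrite mulr_suml mulr_sumr.
Qed.

(** For G the sum of the first n iterates, G - P G = f - P^n f, so E(G, G) is <f, G> minus the sum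
    of the lags n, ..., 2n - 1. With n even these lags pair up to something nonnegative, which
    leaves <f, G>^2 <= kappa <f, G>. *)
Lemma sum_autocov_even_le m : \sum_(k < m + m) c k <= kappa.
Proof.
set n := (m + m)%N; set q := \sum_(k < n) c k.
pose G x := \sum_(k < n) iter k kernel_op f x.
have fG : mudot f G = q.
  by rewrite mudotC mudot_suml; apply: eq_bigr => k _; rewrite mudotC.
have GG j : mudot (iter j kernel_op f) G = \sum_(k < n) c (j + k).
  by rewrite mudotC mudot_suml; apply: eq_bigr => k _; rewrite mudotC mudot_iter.
have dG : dirichlet G = q - \sum_(j < n) c (j + n).
  rewrite dirichletE !mudot_suml -!sumrB; apply: eq_bigr => j _.
  rewrite -mudot_op_sym -iterS !GG -sumrB.
  have tel : \sum_(0 <= k < n) (c (j + k.+1) - c (j + k)) = c (j + n) - c (j + 0).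
    by rewrite telescope_sumr.
  rewrite -opprB -[c j](congr1 c (addn0 j)) -tel -sumrN big_mkord.
  by apply: eq_bigr => k _; rewrite opprB addSnnS.
have tail : 0 <= \sum_(j < n) c (j + n).
  by have := sum_autocov_ge0 m m; under eq_bigr do rewrite addnC.
have := f_poincare G; rewrite fG dG => qle.
have q2 : q ^+ 2 <= kappa * q.
  by apply: le_trans qle _; apply: ler_wpM2l => //; rewrite gerBl.
have [q0|q0] := leP q 0; first exact: le_trans q0 kappa_ge0.
by rewrite expr2 ler_pM2r in q2.
Qed.

(** An odd number of lags leaves one even lag over, at most c(0) <= 2 kappa. *)
Lemma sum_autocov_le n : \sum_(k < n) c k <= 3 * kappa.
Proof.
have [m [->|->]] : exists m, n = (m + m)%N \/ n = (m + m).+1.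
  by exists n./2; rewrite addnn -{1 3}(odd_double_half n); case: odd; [right|left].
  have := sum_autocov_even_le m; have := kappa_ge0; lra.
rewrite big_ord_recr /=.
have := sum_autocov_even_le m; have := autocov0_le; have := autocov_even_le m; lra.
Qed.

(** The truncated differences add up to |s - t|. A new row and column contribute twice the sum of
    the lags minus c(0), hence at most 6 kappa. *)
Lemma sum2_autocov_le n :
  \sum_(s < n) \sum_(t < n) c ((s - t) + (t - s)) <= 6 * kappa * n%:R.
Proof.
elim: n => [|n IH]; first by rewrite big_ord0 mulr0.
have last_sum : \sum_(s < n) c ((s - n) + (n - s)) = \sum_(k < n) c k.+1.
  rewrite (reindex_inj rev_ord_inj); apply: eq_bigr => s _ /=.
  congr c; have := ltn_ord s; lia.
have last_sum' : \sum_(s < n) c ((n - s) + (s - n)) = \sum_(k < n) c k.+1.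
  by rewrite -last_sum; apply: eq_bigr => s _; rewrite addnC.
have q : c 0 + \sum_(k < n) c k.+1 <= 3 * kappa.
  by have := sum_autocov_le n.+1; rewrite big_ord_recl.
rewrite big_ord_recr /=; under eq_bigr do rewrite big_ord_recr /=.
rewrite big_split /= last_sum big_ord_recr /= last_sum' subnn.
have c0 : 0 <= c 0 := autocov_even_ge0 0.
rewrite -[n.+1%:R]natr1 mulrDr mulr1; have := IH.
rewrite addn0; lra.
Qed.

End ReversibleChain.

(** * Matchings as permutations *)

Section Encoding.
Variables (V1 V2 : finType) (b0 : V1 -> V2) (b0' : V2 -> V1).
Hypotheses (b0K : cancel b0 b0') (b0'K : cancel b0' b0).
Implicit Types (s t : {perm V1}) (x z u : V1) (y v : V2) (M : {set V1 * V2}).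

Definition pgraph s : {set V1 * V2} := [set e | e.2 == b0 (s e.1)]%SET.
Definition hgraph s x : {set V1 * V2} :=
  [set e | (e.2 == b0 (s e.1)) && (e.1 != x)]%SET.

Lemma in_pgraph s u v : ((u, v) \in pgraph s) = (v == b0 (s u)).
Proof. by rewrite inE. Qed.

Lemma in_hgraph s x u v : ((u, v) \in hgraph s x) = (v == b0 (s u)) && (u != x).
Proof. by rewrite inE. Qed.

Let b0_inj : injective b0 := can_inj b0K.

Lemma hgraphE s x : hgraph s x = (pgraph s :\ (x, b0 (s x)))%SET.
Proof.
apply/setP => -[u v]; rewrite in_hgraph !inE xpair_eqE /= andbC.
have [->|] := eqVneq u x; rewrite /= ?andbT //.
by case: eqP.
Qed.

Lemma pgraph_matching s : is_matching (pgraph s).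
Proof.
apply/forall_inP => -[u v]; rewrite in_pgraph => /eqP ->.
apply/forall_inP => -[u' v']; rewrite in_pgraph => /eqP -> /=.
by apply/implyP => /orP[/eqP -> //|/eqP/b0_inj/perm_inj -> //].
Qed.

Lemma sub_matching M M' : (M \subset M')%SET -> is_matching M' -> is_matching M.
Proof.
move=> /fintype.subsetP sMM' /forall_inP mM'.
apply/forall_inP => e eM; apply/forall_inP => f fM.
by have /forall_inP/(_ f (sMM' _ fM)) := mM' e (sMM' _ eM).
Qed.

Lemma pgraph_perfect s : pgraph s \in perfect.
Proof.
rewrite inE pgraph_matching /=; apply/andP; split; apply/eqP/setP => w; rewrite !inE.
  apply/negbTE/forallPn; exists (b0 (s w)); by rewrite in_pgraph eqxx.
apply/negbTE/forallPn; exists ((s^-1)%g (b0' w)).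
by rewrite in_pgraph permKV b0'K eqxx.
Qed.

Lemma pgraph_inj : injective pgraph.
Proof.
move=> s t st; apply/permP => x; apply: b0_inj; apply/eqP.
by rewrite -in_pgraph -st in_pgraph.
Qed.

Lemma perfectP M : M \in perfect -> exists s, M = pgraph s.
Proof.
rewrite inE => /and3P[mM /eqP U1 _].
have ex u : exists v, (u, v) \in M.
  have : u \notin unmatched1 M by rewrite U1 inE.
  by rewrite inE negb_forall => /existsP[v]; rewrite negbK; exists v.
pose f u := b0' (xchoose (ex u)).
have fM u : (u, b0 (f u)) \in M by rewrite /f b0'K; exact: (xchooseP (ex u)).
have mMP e e' : e \in M -> e' \in M -> (e.1 == e'.1) || (e.2 == e'.2) -> e = e'.
  move=> eM eM' h; apply/eqP.
  by move/forall_inP: mM => /(_ _ eM)/forall_inP/(_ _ eM')/implyP; apply.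
have finj : injective f.
  move=> u u' e; have := mMP _ _ (fM u) (fM u').
  by rewrite /= e eqxx orbT => /(_ isT) [].
exists (perm finj); apply/setP => -[u v]; rewrite in_pgraph permE.
apply/idP/eqP => [uvM|-> //].
have := mMP _ _ uvM (fM u); by rewrite /= eqxx => /(_ isT) [].
Qed.

Lemma hgraph_matching s x : is_matching (hgraph s x).
Proof. by rewrite hgraphE; apply: sub_matching (pgraph_matching s); exact: subD1set. Qed.

Lemma hgraph_unmatched1 s x : unmatched1 (hgraph s x) = [set x]%SET.
Proof.
apply/setP => u; rewrite !inE; apply/forallP/eqP => [H|-> v]; last first.
  by rewrite in_hgraph eqxx andbF.
apply/eqP; have := H (b0 (s u)); by rewrite in_hgraph eqxx negbK.
Qed.

Lemma hgraph_unmatched2 s x : unmatched2 (hgraph s x) = [set b0 (s x)]%SET.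
Proof.
apply/setP => v; rewrite !inE; apply/forallP/eqP => [H|-> u]; last first.
  by rewrite in_hgraph (inj_eq b0_inj) (inj_eq perm_inj) eq_sym andbN.
have := H ((s^-1)%g (b0' v)); rewrite in_hgraph permKV b0'K eqxx negbK /= => /eqP <-.
by rewrite permKV b0'K.
Qed.

Lemma card_pgraph s : #|pgraph s| = #|V1|.
Proof.
have -> : pgraph s = [set (u, b0 (s u)) | u in [set: V1]]%SET.
  apply/setP => -[u v]; rewrite in_pgraph; apply/eqP/imsetP => [->|[u' _ [-> ->]] //].
  by exists u; rewrite ?inE.
by rewrite card_imset ?cardsT // => u u' [].
Qed.

Lemma hgraph_near s x : hgraph s x \in near_perfect x (b0 (s x)).
Proof.
rewrite inE hgraph_matching hgraph_unmatched1 hgraph_unmatched2 !eqxx !andbT /=.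
have := cardsD1 (x, b0 (s x)) (pgraph s).
by rewrite -hgraphE in_pgraph eqxx card_pgraph => ->.
Qed.

Lemma near_unmatched u v M : M \in near_perfect u v ->
  unmatched1 M = [set u]%SET /\ unmatched2 M = [set v]%SET.
Proof. by rewrite inE => /and4P[_ _ /eqP -> /eqP ->]. Qed.

Lemma hgraph_near_perfectE s x u v :
  (hgraph s x \in near_perfect u v) = (u == x) && (v == b0 (s x)).
Proof.
apply/idP/andP => [/near_unmatched|[/eqP -> /eqP ->]]; last exact: hgraph_near.
rewrite hgraph_unmatched1 hgraph_unmatched2 => -[/set1_inj -> /set1_inj ->].
by rewrite !eqxx.
Qed.

(** Joining the two holes completes [M] to a perfect matching, which is the graph of a
    permutation. *)
Lemma near_perfectP u v M : M \in near_perfect u v ->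
  exists2 s : {perm V1}, b0 (s u) = v & M = hgraph s u.
Proof.
move=> MN; have [U1 U2] := near_unmatched MN.
have uN w : (u, w) \notin M.
  have : u \in unmatched1 M by rewrite U1 inE.
  by rewrite inE => /forallP.
have vN w : (w, v) \notin M.
  have : v \in unmatched2 M by rewrite U2 inE.
  by rewrite inE => /forallP.
have /perfectP[s Ms] : ((u, v) |: M)%SET \in perfect.
  move: MN; rewrite inE => /and4P[/forall_inP mM _ _ _].
  rewrite inE; apply/and3P; split.
  - apply/forall_inP => e /setU1P[->|eM]; apply/forall_inP => f /setU1P[->|fM].
    + by rewrite !eqxx.
    + apply/implyP => /orP[] /= /eqP h; move: fM; rewrite (surjective_pairing f) -h => fM.
        by move: (uN f.2); rewrite fM.
      by move: (vN f.1); rewrite fM.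
    + apply/implyP => /orP[] /= /eqP h; move: eM; rewrite (surjective_pairing e) h => eM.
        by move: (uN e.2); rewrite eM.
      by move: (vN e.1); rewrite eM.
    + by have /forall_inP/(_ f fM) := mM e eM.
  - apply/eqP/setP => w; rewrite !inE; apply/negbTE/forallPn.
    have [->|wu] := eqVneq w u; first by exists v; rewrite !inE eqxx.
    have : w \notin unmatched1 M by rewrite U1 inE.
    rewrite inE negb_forall => /existsP[w']; rewrite negbK => w'M.
    by exists w'; rewrite !inE w'M orbT.
  - apply/eqP/setP => w; rewrite !inE; apply/negbTE/forallPn.
    have [->|wu] := eqVneq w v; first by exists u; rewrite !inE eqxx.
    have : w \notin unmatched2 M by rewrite U2 inE.
    rewrite inE negb_forall => /existsP[w']; rewrite negbK => w'M.
    by exists w'; rewrite !inE w'M orbT.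
have su : b0 (s u) = v.
  by apply/esym/eqP; rewrite -in_pgraph -Ms !inE eqxx.
exists s => //; rewrite hgraphE -Ms su setU1K //.
Qed.

Lemma hgraph_inj s t x z : hgraph s x = hgraph t z -> s = t /\ x = z.
Proof.
move=> e; have := hgraph_near s x; rewrite e hgraph_near_perfectE => /andP[/eqP xz /eqP sx].
split=> //; apply: pgraph_inj.
have h r w : pgraph r = ((w, b0 (r w)) |: hgraph r w)%SET.
  by rewrite hgraphE finset.setD1K // in_pgraph.
by rewrite (h s x) (h t z) e sx xz.
Qed.

Lemma hgraph_not_perfect s x : hgraph s x \notin perfect.
Proof.
rewrite inE hgraph_unmatched1 !negb_and; apply/orP; right; apply/orP; left.
by apply/eqP => /setP/(_ x); rewrite !inE eqxx.
Qed.

Lemma perfect_image : perfect = [set pgraph s | s in [set: {perm V1}]]%SET.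
Proof.
apply/setP => M; apply/idP/imsetP => [/perfectP[s ->]|[s _ ->]].
  by exists s; rewrite ?inE.
exact: pgraph_perfect.
Qed.

Lemma near_perfect_image u v :
  near_perfect u v = [set hgraph s u | s in [set s : {perm V1} | b0 (s u) == v]]%SET.
Proof.
apply/setP => M; apply/idP/imsetP => [/near_perfectP[s su ->]|[s + ->]].
  by exists s; rewrite ?inE ?su.
by rewrite inE => /eqP <-; exact: hgraph_near.
Qed.

Lemma pgraph_Omega s : pgraph s \in Omega.
Proof. by rewrite inE pgraph_perfect. Qed.

Lemma hgraph_Omega s x : hgraph s x \in Omega.
Proof.
rewrite inE; apply/orP; right; apply/bigcupP; exists x => //.
by apply/bigcupP; exists (b0 (s x)) => //; exact: hgraph_near.
Qed.

Lemma OmegaP M : M \in Omega -> (exists s, M = pgraph s) \/ (exists s x, M = hgraph s x).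
Proof.
rewrite inE => /orP[/perfectP|/bigcupP[u _ /bigcupP[v _ /near_perfectP[s _ ->]]]]; first by left.
by right; exists s, u.
Qed.

Section Sums.
Variables (R : realFieldType) (F : {set V1 * V2} -> R).

Lemma sum_perfect : \sum_(M in perfect) F M = \sum_s F (pgraph s).
Proof.
rewrite perfect_image big_imset /=; last by move=> s t _ _ /pgraph_inj.
by apply: eq_bigl => s; rewrite inE.
Qed.

Lemma sum_near_perfect u v :
  \sum_(M in near_perfect u v) F M = \sum_(s : {perm V1} | b0 (s u) == v) F (hgraph s u).
Proof.
rewrite near_perfect_image big_imset /=; last by move=> s t _ _ /hgraph_inj[].
by apply: eq_bigl => s; rewrite inE.
Qed.

Lemma sum_Omega :
  \sum_(M in Omega) F M = \sum_s F (pgraph s) + \sum_u \sum_s F (hgraph s u).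
Proof.
have dec : Omega = perfect :|: [set hgraph j.1 j.2 | j in [set: {perm V1} * V1]]
    :> {set {set V1 * V2}}.
  apply/setP => M; rewrite [in RHS]inE; apply/idP/orP.
    case/OmegaP=> [[s ->]|[s [x ->]]]; first by left; exact: pgraph_perfect.
    by right; apply/imsetP; exists (s, x); rewrite ?inE.
  case=> [/perfectP[s ->]|/imsetP[[s x] _ ->]]; [exact: pgraph_Omega|exact: hgraph_Omega].
rewrite dec (eq_bigl _ _ (fun M => finset.in_setU M _ _)) bigU /=; last first.
  rewrite disjoint_sym; apply/pred0P => M /=; apply/negbTE/negP => /andP[/imsetP[[s x] _ ->]].
  by rewrite (negPf (hgraph_not_perfect s x)).
rewrite sum_perfect; congr (_ + _).
rewrite big_imset /=; last by move=> [s x] [t z] _ _ /= /hgraph_inj[-> ->].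
rewrite (eq_bigl predT); last by move=> j; rewrite inE.
by rewrite -(pair_bigA _ (fun s x => F (hgraph s x))) /= exchange_big.
Qed.

End Sums.

Section Activity.
Variables (R : realType) (lam : V1 -> V2 -> R).
Let l x z := lam x (b0 z).

Lemma activity_pgraph s : activity lam (pgraph s) = pweight l s.
Proof.
rewrite /activity /pweight.
have -> : pgraph s = [set (u, b0 (s u)) | u in [set: V1]]%SET.
  apply/setP => -[u v]; rewrite in_pgraph; apply/eqP/imsetP => [->|[u' _ [-> ->]] //].
  by exists u; rewrite ?inE.
by rewrite big_imset /= => [|u u' _ _ [] //]; apply: eq_bigl => u; rewrite inE.
Qed.

Lemma activity_hgraph s x : activity lam (hgraph s x) * l x (s x) = pweight l s.
Proof.
rewrite -activity_pgraph /activity [RHS](big_setD1 (x, b0 (s x))) ?in_pgraph //=.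
by rewrite -hgraphE mulrC.
Qed.

End Activity.

Lemma adj_sym M M' : adj M M' = adj M' M.
Proof. by rewrite /adj !orbA [delete_move M M' || _]orbC -!orbA [slide_move M M' || _]orbC. Qed.

Lemma adj_delete s x : adj (pgraph s) (hgraph s x).
Proof.
apply/orP; left; rewrite /delete_move pgraph_perfect /=.
by apply/exists_inP; exists (x, b0 (s x)); rewrite ?in_pgraph ?hgraphE.
Qed.

(** The edge at [z] is redirected to the hole of V2, which moves to the former partner of [z]. *)
Lemma adj_slide2 s x z : x != z -> adj (hgraph s x) (hgraph (tperm x z * s)%g x).
Proof.
move=> xz; apply/or4P; apply: Or43; apply/existsP; exists x; apply/existsP; exists (b0 (s x)).
rewrite hgraph_near /=; apply/exists_inP; exists (z, b0 (s z)).
  by rewrite in_hgraph eqxx eq_sym.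
apply/orP; left; apply/eqP/setP => -[u v]; rewrite !inE /= !xpair_eqE /= permM.
case: tpermP => [->|->|/eqP ux /eqP uz].
- by rewrite eqxx !andbF (negPf xz).
- by rewrite eqxx /= (eq_sym z) xz andbT; case: (v == b0 (s z)); rewrite ?andbF ?orbF.
- by rewrite (negPf uz) ux.
Qed.

(** The partner of [z] is taken over by the hole [x] of V1, and [z] becomes the hole. *)
Lemma adj_slide1 s x z : x != z -> adj (hgraph s x) (hgraph (tperm x z * s)%g z).
Proof.
move=> xz; apply/or4P; apply: Or43; apply/existsP; exists x; apply/existsP; exists (b0 (s x)).
rewrite hgraph_near /=; apply/exists_inP; exists (z, b0 (s z)).
  by rewrite in_hgraph eqxx eq_sym.
apply/orP; right; apply/eqP/setP => -[u v]; rewrite !inE /= !xpair_eqE /= permM.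
case: tpermP => [->|->|/eqP ux /eqP uz].
- by rewrite eqxx xz !andbF /= andbT orbF.
- by rewrite eqxx (eq_sym z) (negPf xz) /= !andbF; case: (v == b0 (s z)).
- by rewrite (negPf uz) (negPf ux).
Qed.

End Encoding.

(** * From the Markov property to autocovariances *)

Section FiniteValued.
Variables (R : realType) (d : measure_display) (W : measurableType d).
Variable Pr : probability W R.
Local Open Scope classical_set_scope.

Lemma expectation_finite (F : finType) (Z : W -> F) (phi : F -> R) :
  (forall z, measurable (Z @^-1` [set z])) ->
  ('E_Pr[fun om => phi (Z om)]
     = (\sum_z phi z * fine (Pr (Z @^-1` [set z])))%R%:E)%E.
Proof.
move=> mZ; rewrite unlock.
have -> : (fun om => (phi (Z om))%:E)
   = (fun om => \sum_z (phi z)%:E * (\1_(Z @^-1` [set z]) om)%:E)%E.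
  apply/funext => om; rewrite (bigD1 (Z om)) //= big1 ?adde0 => [|z zN].
    by rewrite indicE mem_set ?mule1.
  by rewrite indicE memNset ?mule0 //= => e; rewrite e eqxx in zN.
have I z : Pr.-integrable setT (fun om => (\1_(Z @^-1` [set z]) om)%:E).
  exact: integrable_indic.
rewrite integral_sum //=; last by move=> z; exact: integrableZl.
rewrite -sumEFin; apply: eq_bigr => z _.
rewrite integralZl // integral_indic // setIT EFinM fineK //.
exact: fin_num_measure.
Qed.

End FiniteValued.

Section MarkovAverages.
Variables (R : realType) (S : finType) (mu : S -> R) (K : S -> S -> R).
Variables (d : measure_display) (W : measurableType d) (Pr : probability W R).
Variable X : nat -> W -> S.
Hypothesis X_chain : markov_chain mu K Pr X.
Local Open Scope classical_set_scope.

Let mX t x : measurable (X t @^-1` [set x]).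
Proof. by case: X_chain. Qed.

(** The Markov property is given for complete pasts, so the past is packed into one finitely valued
    variable and all expectations become finite sums. *)
Definition history t om : {ffun 'I_t.+1 -> S} := [ffun i : 'I_t.+1 => X i om].

Lemma historyE t (g : {ffun 'I_t.+1 -> S}) :
  history t @^-1` [set g]
    = [set om | forall s, (s <= t)%N -> X s om = g (inord s)].
Proof.
apply/seteqP; split => om /=.
  by move=> <- s st; rewrite ffunE inordK.
by move=> H; apply/ffunP => i; rewrite ffunE H -1?ltnS // inord_val.
Qed.

Lemma measurable_history t g : measurable (history t @^-1` [set g]).
Proof.
have -> : history t @^-1` [set g]
    = \bigcap_(i in [set: 'I_t.+1]) (X i @^-1` [set g i]).
  apply/seteqP; split => om /=; first by move=> <- i _; rewrite /= ffunE.
  by move=> H; apply/ffunP => i; rewrite ffunE; exact: H.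
by apply: fin_bigcap_measurable => [|i _]; [exact: finite_finset|exact: mX].
Qed.

Definition expect (Y : W -> R) : R := fine ('E_Pr[Y])%E.

Lemma expect_history t (F : {ffun 'I_t.+1 -> S} -> R) :
  expect (fun om => F (history t om))
    = \sum_g F g * fine (Pr (history t @^-1` [set g])).
Proof. by rewrite /expect (expectation_finite Pr F (@measurable_history t)). Qed.

Lemma expect_next t (F : {ffun 'I_t.+1 -> S} -> R) (psi : S -> R) :
  expect (fun om => F (history t om) * psi (X t.+1 om))
    = expect (fun om => F (history t om) * kernel_op K psi (X t om)).
Proof.
pose Z om := (history t om, X t.+1 om).
have ZE g y : Z @^-1` [set (g, y)] = history t @^-1` [set g] `&` X t.+1 @^-1` [set y].
  by apply/seteqP; split => om /=; [case=> <- <-|case=> ? ?; congr pair].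
have mZ z : measurable (Z @^-1` [set z]).
  by case: z => g y; rewrite ZE; apply: measurableI; [exact: measurable_history|exact: mX].
have := expectation_finite Pr (fun z : {ffun 'I_t.+1 -> S} * S => F z.1 * psi z.2) mZ.
rewrite /expect /Z /= => -> /=.
have -> : (fun om => F (history t om) * kernel_op K psi (X t om)) =
    (fun om => (fun g : {ffun 'I_t.+1 -> S} => F g * kernel_op K psi (g ord_max)) (history t om)).
  by apply/funext => om; rewrite ffunE.
rewrite -[RHS]/(expect _) (expect_history (fun g => F g * kernel_op K psi (g ord_max))).
transitivity (\sum_g \sum_y F g * psi y * fine (Pr (Z @^-1` [set (g, y)]))).
  by rewrite pair_bigA; apply: eq_bigr => -[].
apply: eq_bigr => g _; rewrite /kernel_op mulr_sumr mulr_suml; apply: eq_bigr => y _.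
case: X_chain => _ _ /(_ t (fun s => g (inord s)) y) /=.
rewrite -historyE ZE => ->.
have -> : inord t = ord_max :> 'I_t.+1 by apply/val_inj; rewrite /= inordK.
rewrite fineM ?fin_num_measure //=; last exact: measurable_history.
ring.
Qed.

(** Integrates out the last step and absorbs it into [psi]; the factor at time [s] is a function of
    the history and stays untouched. *)
Lemma expect_lag (phi psi : S -> R) s k :
  expect (fun om => phi (X s om) * psi (X (s + k)%N om))
    = expect (fun om => phi (X s om) * iter k (kernel_op K) psi (X s om)).
Proof.
elim: k psi => [|k IH] psi; first by rewrite addn0.
rewrite iterSr -IH addnS.
have := @expect_next (s + k) (fun g => phi (g (inord s))) psi.
have h om : (history (s + k) om) (inord s) = X s om.
  by rewrite ffunE inordK // ltnS leq_addr.
by under eq_fun do rewrite h; move=> ->; under eq_fun do rewrite h.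
Qed.

Hypothesis K_sum1 : forall x, \sum_y K x y = 1.
Hypothesis K_rev : forall x y, mu x * K x y = mu y * K y x.

Lemma expect_stationary (psi : S -> R) t :
  expect (fun om => psi (X t om)) = \sum_x mu x * psi x.
Proof.
elim: t psi => [|t IH] psi.
  rewrite /expect (expectation_finite Pr psi (mX 0)) /=.
  by case: X_chain => _ X0 _; apply: eq_bigr => x _; rewrite X0 /= mulrC.
have := @expect_next t (fun=> 1) psi.
under eq_fun do rewrite mul1r; move=> ->.
under eq_fun do rewrite mul1r; rewrite IH.
rewrite -[RHS](mudot_diagr K_sum1 K_rev); apply: eq_bigr => x _.
by rewrite mulr_sumr; apply: eq_bigr => y _; rewrite mulrA.
Qed.

Lemma expect_product (f : S -> R) s t :
  expect (fun om => f (X s om) * f (X t om))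
    = autocov mu K f ((s - t) + (t - s)).
Proof.
wlog st : s t / (s <= t)%N => [H|].
  have [|/ltnW ts] := leqP s t; first exact: H.
  by rewrite addnC -H //; congr expect; apply/funext => om; rewrite mulrC.
have := expect_lag f f s (t - s); rewrite subnKC // => ->.
rewrite (expect_stationary (fun x => f x * iter (t - s) (kernel_op K) f x)).
by have /eqP -> := st.
Qed.

Lemma variance_average (g : S -> R) (T : nat) : (0 < T)%N -> \sum_x mu x = 1 ->
  let f x := g x - \sum_z mu z * g z in
  ('V_Pr[fun om => (T%:R^-1 * \sum_(t < T) g (X t om))%R]
    = (T%:R ^- 2 * \sum_(s < T) \sum_(t < T) autocov mu K f ((s - t) + (t - s)))%:E)%E.
Proof.
(* The average now runs over T + 1 times, exactly the coordinates of [history T]. *)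
case: T => // T _ mu1 f; set m := \sum_z mu z * g z in f *.
pose avg (a : S -> R) (h : {ffun 'I_T.+1 -> S}) := T.+1%:R^-1 * \sum_(t < T.+1) a (h t).
have avgE a : (fun om => T.+1%:R^-1 * \sum_(t < T.+1) a (X t om))
    = (fun om => avg a (history T om)).
  by apply/funext => om; congr (_ * _); apply: eq_bigr => t _; rewrite ffunE.
have mean : expect (fun om => T.+1%:R^-1 * \sum_(t < T.+1) g (X t om)) = m.
  rewrite avgE expect_history /avg.
  under eq_bigr do rewrite -mulrA mulr_suml.
  rewrite -mulr_sumr exchange_big /=.
  have st (t : 'I_T.+1) : \sum_(h : {ffun 'I_T.+1 -> S})
      g (h t) * fine (Pr (history T @^-1` [set h])) = m.
    rewrite /m -(expect_stationary g t) -(expect_history (fun h : {ffun 'I_T.+1 -> S} => g (h t))).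
    by congr expect; apply/funext => om; rewrite ffunE.
  by rewrite (eq_bigr _ (fun t _ => st t)) sumr_const card_ord -[m *+ _]mulr_natl mulKf.
have centered : (fun om => T.+1%:R^-1 * \sum_(t < T.+1) g (X t om)) \- cst m
    = (fun om => T.+1%:R^-1 * \sum_(t < T.+1) f (X t om)).
  apply/funext => om /=; rewrite sumrB sumr_const card_ord mulrBr -[m *+ _]mulr_natl mulKf //.
rewrite /variance unlock -/(expect _) mean centered.
have -> : ((fun om => T.+1%:R^-1 * \sum_(t < T.+1) f (X t om)) *
   (fun om => T.+1%:R^-1 * \sum_(t < T.+1) f (X t om)))%R =
   (fun om => (fun h => avg f h ^+ 2) (history T om)).
  by apply/funext => om; rewrite /= avgE.
rewrite (expectation_finite Pr (fun h => avg f h ^+ 2) (@measurable_history T)).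
congr (_%:E); rewrite /avg.
transitivity (T.+1%:R ^- 2 * \sum_(h : {ffun 'I_T.+1 -> S}) (\sum_(s < T.+1) \sum_(t < T.+1)
    f (h s) * f (h t) * fine (Pr (history T @^-1` [set h])))).
  rewrite mulr_sumr; apply: eq_bigr => h _.
  rewrite exprMn exprVn [(\sum_(_ < _) _) ^+ 2]expr2 -mulrA; congr (_ * _).
  rewrite mulr_suml mulr_suml; apply: eq_bigr => s _.
  by rewrite mulr_sumr mulr_suml.
congr (_ * _); rewrite exchange_big; apply: eq_bigr => s _.
rewrite exchange_big; apply: eq_bigr => t _ /=.
rewrite -expect_product -(expect_history (fun h : {ffun 'I_T.+1 -> S} => f (h s) * f (h t))).
by congr expect; apply/funext => om; rewrite !ffunE.
Qed.

(** The self-loop of [jsvB] is 1 minus a sum, so its sign needs an argument. Instead of counting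
    neighbours: [mu x * K x y] is the probability of moving from [x] to [y] at time 0. *)
Lemma markov_kernel_ge0 x y : 0 < mu x -> 0 <= K x y.
Proof.
move=> mx; case: X_chain => _ X0 /(_ 0%N (fun=> x) y) /=.
set past := [set om | _].
have -> : past = X 0%N @^-1` [set x].
  by apply/seteqP; split => om /=; [exact|move=> ? [|]].
rewrite X0 => e.
have : (0%:E <= Pr (X 0%N @^-1` [set x] `&` X 1 @^-1` [set y]))%E by exact: measure_ge0.
by rewrite e -EFinM lee_fin pmulr_rge0.
Qed.

End MarkovAverages.

(** * The boosted chain *)

(** H_n <= 1 + ln n, and the additive 1 is at most 2 ln n because ln 2 >= 1/2. *)
Lemma harmonic_le (R : realType) (n : nat) : (2 <= n)%N ->
  \sum_(i < n) i.+1%:R^-1 <= 3 * ln n%:R :> R.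
Proof.
have step (k : nat) : k.+2%:R^-1 <= ln k.+2%:R - ln k.+1%:R :> R.
  have k1 : 0 < k.+1%:R :> R by rewrite ltr0n.
  have k2 : 0 < k.+2%:R :> R by rewrite ltr0n.
  rewrite -opprB lerNr -ln_div ?posrE //.
  have -> : k.+1%:R / k.+2%:R = 1 + - k.+2%:R^-1 :> R.
    have -> : k.+1%:R = k.+2%:R - 1 :> R by rewrite -[k.+2%:R]natr1 addrK.
    by rewrite mulrBl mul1r divff // lt0r_neq0.
  by apply: le_ln1Dx; rewrite ltrN2 invf_lt1 // ltr1n.
case: n => // n n1.
have H1 : \sum_(i < n.+1) i.+1%:R^-1 <= 1 + ln n.+1%:R :> R.
  elim: n {n1} => [|n IH]; first by rewrite big_ord1 invr1 lerDl ln_ge0.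
  rewrite big_ord_recr /=; apply: le_trans (lerD IH (step n)) _.
  by rewrite -addrA [ln _ + (_ - _)]addrC subrK.
have h2 : 2^-1 <= ln 2%:R :> R by have := step 0; rewrite ln1 subr0.
have : ln 2%:R <= ln n.+1%:R :> R by rewrite ler_ln ?posrE ?ltr0n // ler_nat.
lra.
Qed.

Lemma bijection_of_card (V1 V2 : finType) : #|V1| = #|V2| ->
  exists b : V1 -> V2, exists b' : V2 -> V1, cancel b b' /\ cancel b' b.
Proof.
move=> e; exists (fun x => enum_val (cast_ord e (enum_rank x))).
exists (fun y => enum_val (cast_ord (esym e) (enum_rank y))).
by split=> x; rewrite enum_valK ?cast_ordK ?cast_ordKV enum_rankK.
Qed.

Section BoostedChain.
Variables (R : realType) (V1 V2 : finType) (b0 : V1 -> V2) (b0' : V2 -> V1).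
Hypotheses (b0K : cancel b0 b0') (b0'K : cancel b0' b0).
Variables lam w : V1 -> V2 -> R.
Hypothesis lam_gt0 : forall u v, 0 < lam u v.
Hypothesis w_gt0 : forall u v, 0 < w u v.
Hypothesis w_rough : rough lam w.
Hypothesis V1_gt0 : (0 < #|V1|)%N.
Implicit Types (s f : {perm V1}) (u z : V1).

Let n : R := #|V1|%:R.
Let l x z := lam x (b0 z).
Let W := pweight l.
Let A := \sum_s W s.
Let B u z := \sum_(s : {perm V1} | s u == z) W s.
Let Z := \sum_(M in Omega) boosted_weight lam w M.
Let K := jsvB lam w.
Let mu (x : state V1 V2) := piB lam w (val x).

Let l_gt0 x z : 0 < l x z. Proof. exact: lam_gt0. Qed.
Let n_gt0 : 0 < n. Proof. by rewrite ltr0n. Qed.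
Let n_ge1 : 1 <= n. Proof. by rewrite ler1n. Qed.
Let A_gt0 : 0 < A. Proof. exact: sum_pweight_all_gt0. Qed.
Let B_gt0 u z : 0 < B u z. Proof. exact: sum_pweight_gt0. Qed.
Let W_gt0 s : 0 < W s. Proof. exact: pweight_gt0. Qed.

Lemma set_activity_perfect : set_activity lam perfect = A.
Proof.
rewrite /set_activity (sum_perfect b0K b0'K); apply: eq_bigr => s _.
exact: activity_pgraph.
Qed.

Lemma activity_hgraphE s u : activity lam (hgraph b0 s u) = W s / l u (s u).
Proof. by rewrite /W -(activity_hgraph b0 lam s u) mulfK // lt0r_neq0. Qed.

Lemma set_activity_near u z : set_activity lam (near_perfect u (b0 z)) = B u z / l u z.
Proof.
rewrite /set_activity (sum_near_perfect b0K b0'K) mulr_suml.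
apply: eq_big => [s|s /eqP e]; first by rewrite (can_eq b0K).
by rewrite activity_hgraphE (can_inj b0K e).
Qed.

Definition hole_mass u z : R := w u (b0 z) * (B u z / l u z).

Lemma hole_mass_rough u z : A / 2 <= hole_mass u z <= 2 * A.
Proof.
have := w_rough u (b0 z); rewrite /ideal_weight set_activity_perfect set_activity_near.
have BL : 0 < B u z / l u z by rewrite divr_gt0.
rewrite invf_div mulrA -/(hole_mass u z) => /andP[h1 h2].
by rewrite ler_pdivrMr // in h2; rewrite ler_pdivlMr // in h1; rewrite mulrC h1.
Qed.

Lemma boosted_pgraph s : boosted_weight lam w (pgraph b0 s) = n ^+ 2 * W s.
Proof. by rewrite /boosted_weight (pgraph_perfect b0K b0'K) activity_pgraph. Qed.

Lemma boosted_hgraph s u :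
  boosted_weight lam w (hgraph b0 s u) = w u (b0 (s u)) * (W s / l u (s u)).
Proof.
rewrite /boosted_weight (negPf (hgraph_not_perfect _ _ _)) (bigD1 u) //=.
rewrite [X in _ + X]big1 => [|u' u'u].
  rewrite addr0 (eq_bigl (pred1 (b0 (s u)))).
    by rewrite big_pred1_eq activity_hgraphE.
  by move=> v; rewrite (hgraph_near_perfectE b0K b0'K) eqxx.
by apply: big1 => v; rewrite (hgraph_near_perfectE b0K b0'K) (negPf u'u).
Qed.

Lemma sum_perm_by_image (F : {perm V1} -> R) u :
  \sum_s F s = \sum_z \sum_(s : {perm V1} | s u == z) F s.
Proof. by rewrite (partition_big (fun s : {perm V1} => s u) predT). Qed.

Lemma sum_hole_mass u z :
  \sum_(s : {perm V1} | s u == z) boosted_weight lam w (hgraph b0 s u) = hole_mass u z.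
Proof.
rewrite /hole_mass mulr_suml mulr_sumr; apply: eq_bigr => s /eqP e.
by rewrite boosted_hgraph e.
Qed.

Lemma normalizer_eq : Z = n ^+ 2 * A + \sum_u \sum_z hole_mass u z.
Proof.
rewrite /Z (sum_Omega b0K b0'K); congr (_ + _).
  by rewrite mulr_sumr; apply: eq_bigr => s _; rewrite boosted_pgraph.
apply: eq_bigr => u _; rewrite (sum_perm_by_image _ u); apply: eq_bigr => z _.
exact: sum_hole_mass.
Qed.

Lemma hole_mass_gt0 u z : 0 < hole_mass u z.
Proof. by rewrite /hole_mass mulr_gt0 ?divr_gt0. Qed.

Lemma normalizer_gt0 : 0 < Z.
Proof.
rewrite normalizer_eq; apply: ltr_pwDl; first by rewrite mulr_gt0 // exprn_gt0.
by apply: sumr_ge0 => u _; apply: sumr_ge0 => z _; rewrite ltW ?hole_mass_gt0.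
Qed.

Lemma normalizer_le : Z <= 3 * n ^+ 2 * A.
Proof.
have : \sum_u \sum_z hole_mass u z <= \sum_(u : V1) \sum_(z : V1) 2 * A.
  by apply: ler_sum => u _; apply: ler_sum => z _; have /andP[] := hole_mass_rough u z.
have -> : \sum_(u : V1) \sum_(z : V1) 2 * A = n * (n * (2 * A)).
  by rewrite !sumr_const -[LHS]mulr_natl -[2 * A *+ _]mulr_natl.
rewrite normalizer_eq; lra.
Qed.

Lemma piB_pgraph s : piB lam w (pgraph b0 s) = n ^+ 2 * W s / Z.
Proof. by rewrite /piB boosted_pgraph. Qed.

Lemma piB_hgraph s u :
  piB lam w (hgraph b0 s u) = w u (b0 (s u)) * (W s / l u (s u)) / Z.
Proof. by rewrite /piB boosted_hgraph. Qed.

Lemma piB_gt0 M : M \in Omega -> 0 < piB lam w M.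
Proof.
case/(OmegaP b0'K) => [[s ->]|[s [u ->]]].
  by rewrite piB_pgraph divr_gt0 ?normalizer_gt0 // mulr_gt0 // exprn_gt0.
by rewrite piB_hgraph divr_gt0 ?normalizer_gt0 // mulr_gt0 // divr_gt0.
Qed.

(** Perfect matchings carry at least a third of the mass; the generous factor is the one of
    [hole_density_le], so that both ends of any move obey the same bound. *)
Lemma perfect_density_le s : perfect_density l s <= 6 * n ^+ 2 * piB lam w (pgraph b0 s).
Proof.
rewrite /perfect_density -/W -/A piB_pgraph ler_pdivrMr // mulrA.
rewrite mulrAC ler_pdivlMr ?normalizer_gt0 //.
rewrite [leLHS]mulrC; have h : Z * W s <= 3 * n ^+ 2 * A * W s.
  by rewrite ler_pM2r // normalizer_le.
apply: le_trans h _.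
have e : 3 * n ^+ 2 * A * W s = 3 * n ^+ 2 * (A * W s) by ring.
have -> : 6 * n ^+ 2 * (n ^+ 2 * W s) * A = (3 * n ^+ 2 * (A * W s)) * (2 * n ^+ 2) by ring.
rewrite e ler_peMr ?mulr_ge0 ?exprn_ge0 // ?ltW //.
have : 1 <= n ^+ 2 by rewrite exprn_ege1.
lra.
Qed.

(** Roughness gives the class unnormalised mass at least A / 2, against a total of at most 3 n^2
    A. *)
Lemma hole_density_le s u : hole_density l s u <= 6 * n ^+ 2 * piB lam w (hgraph b0 s u).
Proof.
rewrite /hole_density -/W -/(B u (s u)) piB_hgraph.
rewrite ler_pdivrMr //.
have -> : 6 * n ^+ 2 * (w u (b0 (s u)) * (W s / l u (s u)) / Z) * B u (s u)
   = W s * (6 * n ^+ 2 * hole_mass u (s u)) / Z by rewrite /hole_mass; ring.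
rewrite ler_pdivlMr ?normalizer_gt0 //.
rewrite ler_pM2l //; apply: le_trans normalizer_le _.
have /andP[h _] := hole_mass_rough u (s u).
have n2 : 0 < n ^+ 2 by rewrite exprn_gt0.
have -> : 6 * n ^+ 2 * hole_mass u (s u) = 3 * n ^+ 2 * (2 * hole_mass u (s u)) by ring.
by rewrite ler_pM2l ?mulr_gt0 //; lra.
Qed.

Lemma state_sum (F : {set V1 * V2} -> R) :
  \sum_(x : state V1 V2) F (val x)
    = \sum_s F (pgraph b0 s) + \sum_u \sum_s F (hgraph b0 s u).
Proof. by rewrite -(sum_Omega b0K b0'K) (big_sub (mem Omega)). Qed.

Lemma mu_gt0 x : 0 < mu x.
Proof. exact/piB_gt0/valP. Qed.

Lemma mu_sum1 : \sum_x mu x = 1.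
Proof.
rewrite /mu state_sum -(sum_Omega b0K b0'K) /piB -mulr_suml -/Z mulfV //.
exact/lt0r_neq0/normalizer_gt0.
Qed.

Lemma jsvB_sum1 x : \sum_y K x y = 1.
Proof.
rewrite (bigD1 x) //= /K {1}/jsvB eqxx.
rewrite [X in _ + X](eq_bigr (fun y => jsv_move lam w (val x) (val y))); first by rewrite subrK.
by move=> y yx; rewrite /jsvB eq_sym (negPf yx).
Qed.

Lemma mu_move x y :
  mu x * jsv_move lam w (val x) (val y)
    = if adj (val x) (val y) then (4 * n)^-1 * Num.min (mu x) (mu y) else 0.
Proof.
rewrite /jsv_move; case: ifP => _; last by rewrite mulr0.
rewrite mulrCA; congr (_ * _).
have m0 := mu_gt0 x; rewrite -/(mu x) -/(mu y) minr_pMr ?ltW //.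
by rewrite mulr1 mulrC divfK // lt0r_neq0.
Qed.

Lemma jsvB_rev x y : mu x * K x y = mu y * K y x.
Proof.
rewrite /K /jsvB; have [->//|xy] := eqVneq x y.
by rewrite !mu_move adj_sym minC.
Qed.

(** * Comparison of the move energy with the Dirichlet form *)

Definition pstate s : state V1 V2 := exist (fun M => M \in Omega) _ (pgraph_Omega b0K b0'K s).
Definition hstate s u : state V1 V2 := exist (fun M => M \in Omega) _ (hgraph_Omega b0K b0'K s u).

Lemma hstate_inj s x f z : hstate s x = hstate f z -> s = f /\ x = z.
Proof. by move/(congr1 val)/(hgraph_inj b0K b0'K). Qed.

Hypothesis K_ge0 : forall x y, 0 <= K x y.
Variable g : state V1 V2 -> R.
Let D := dirichlet mu K g.
Let gP s := g (pstate s).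
Let gN s u := g (hstate s u).

Lemma conductance_le x y p q : x != y -> adj (val x) (val y) ->
  p <= 6 * n ^+ 2 * mu x -> q <= 6 * n ^+ 2 * mu y ->
  Num.min p q <= 24 * n ^+ 3 * (mu x * K x y).
Proof.
move=> xy axy hp hq; rewrite /K /jsvB (negPf xy) mu_move axy.
have -> : 24 * n ^+ 3 * ((4 * n)^-1 * Num.min (mu x) (mu y))
   = 6 * n ^+ 2 * Num.min (mu x) (mu y).
  by field; rewrite lt0r_neq0.
rewrite minr_pMr; last by rewrite mulr_ge0 ?exprn_ge0 // ltW.
by rewrite le_min !ge_min hp hq orbT.
Qed.

(** Each index is sent to an ordered pair of states, and the Dirichlet form is half the sum over
    such pairs: this doubles the 24 of [conductance_le]. *)
Lemma gradient_sum_le (J : finType) (P : pred J) (a b : J -> state V1 V2) (p q : J -> R) :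
  {in P &, injective (fun j => (a j, b j))} ->
  (forall j, P j -> a j != b j /\ adj (val (a j)) (val (b j))) ->
  (forall j, p j <= 6 * n ^+ 2 * mu (a j)) -> (forall j, q j <= 6 * n ^+ 2 * mu (b j)) ->
  \sum_(j | P j) Num.min (p j) (q j) * (g (a j) - g (b j)) ^+ 2 <= 48 * n ^+ 3 * D.
Proof.
move=> inj adjP hp hq.
have -> : 48 * n ^+ 3 * D = \sum_(z : state V1 V2 * state V1 V2)
    24 * n ^+ 3 * (mu z.1 * K z.1 z.2) * (g z.1 - g z.2) ^+ 2.
  rewrite /D /dirichlet pair_bigA /= mulrA.
  have -> : 48 * n ^+ 3 / 2 = 24 * n ^+ 3 by field.
  by rewrite mulr_sumr; apply: eq_bigr => z _; rewrite !mulrA.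
apply: (@ler_sum_inj _ _ _ _ _ _ _ (fun j => (a j, b j))) => //.
  move=> z _; apply: mulr_ge0; last exact: sqr_ge0.
  apply: mulr_ge0; first by rewrite mulr_ge0 // exprn_ge0 // ltW.
  by rewrite mulr_ge0 // ltW // mu_gt0.
move=> j /adjP[ab abadj]; split=> //=.
by apply: ler_wpM2r; [exact: sqr_ge0|exact: conductance_le].
Qed.

Lemma min_energy_le : min_energy l gP gN <= 144 * n ^+ 3 * D.
Proof.
have -> : 144 * n ^+ 3 * D = 48 * n ^+ 3 * D + (48 * n ^+ 3 * D + 48 * n ^+ 3 * D) by ring.
rewrite /min_energy; apply: lerD; last apply: lerD.
- apply: (gradient_sum_le (P := predT) (a := fun j => pstate j.1)
    (b := fun j => hstate j.1 j.2)) => [[s x] [t z] _ _ []|j _|j|j].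
  + by move=> _ /(hgraph_inj b0K b0'K)[-> ->].
  + split; last exact: adj_delete.
    apply/eqP => /(congr1 val) /= e; have := hgraph_not_perfect b0 j.1 j.2.
    by rewrite -e (pgraph_perfect b0K b0'K).
  + exact: perfect_density_le.
  + exact: hole_density_le.
(* Indices with equal points describe no move; their gradient is zero, and discarding them makes the
   map to pairs of states injective. *)
- rewrite (bigID (fun j : {perm V1} * (V1 * V1) => j.2.1 != j.2.2)) /=.
  rewrite [X in _ + X]big1 ?addr0 => [|[s [x z]] /=]; last first.
    by rewrite negbK => /eqP ->; rewrite /slide2_grad tperm1 mul1g subrr expr0n mulr0.
  apply: (gradient_sum_le (a := fun j => hstate j.1 j.2.1)
    (b := fun j => hstate (tperm j.2.1 j.2.2 * j.1)%g j.2.1))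
    => [[s [x z]] [t [x' z']] _ _ []|[s [x z]] /= xz|j|j].
  + move=> /(hgraph_inj b0K b0'K)[-> ->] /(hgraph_inj b0K b0'K)[/mulIg e _].
    by have := congr1 (fun f : {perm V1} => f x') e; rewrite !tpermL => ->.
  + split; last exact: adj_slide2.
    apply/eqP => /hstate_inj[e _]; have := congr1 (fun f : {perm V1} => f x) e.
    by rewrite permM tpermL => /perm_inj/eqP; rewrite (negPf xz).
  + exact: hole_density_le.
  + exact: hole_density_le.
- rewrite (bigID (fun j : {perm V1} * (V1 * V1) => j.2.1 != j.2.2)) /=.
  rewrite [X in _ + X]big1 ?addr0 => [|[s [x z]] /=]; last first.
    by rewrite negbK => /eqP ->; rewrite /slide1_grad tperm1 mul1g subrr expr0n mulr0.
  apply: (gradient_sum_le (a := fun j => hstate j.1 j.2.1)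
    (b := fun j => hstate (tperm j.2.1 j.2.2 * j.1)%g j.2.2))
    => [[s [x z]] [t [x' z']] _ _ []|[s [x z]] /= xz|j|j].
  + by move=> /(hgraph_inj b0K b0'K)[-> ->] /(hgraph_inj b0K b0'K)[_ ->].
  + split; last exact: adj_slide1.
    by apply/eqP => /hstate_inj[_ e]; rewrite e eqxx in xz.
  + exact: hole_density_le.
  + exact: hole_density_le.
Qed.

Hypothesis V1_ge2 : (2 <= #|V1|)%N.
Definition gap_rate : R := 1728 * n ^+ 3 * ln n.
Let mP := perfect_mean l gP.
Let mH u z := hole_mean l gN u z.

Lemma dirichlet_ge0 : 0 <= D.
Proof.
rewrite mulr_ge0 ?invr_ge0 //; apply: sumr_ge0 => x _; apply: sumr_ge0 => y _.
by rewrite mulr_ge0 ?sqr_ge0 // mulr_ge0 // ltW // mu_gt0.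
Qed.

Lemma gap_rate_gt0 : 0 < gap_rate.
Proof.
rewrite /gap_rate; apply: mulr_gt0; last by rewrite ln_gt0 // ltr1n.
by apply: mulr_gt0; [rewrite ltr0n|exact: exprn_gt0].
Qed.

Lemma hole_perfect_gap u z : (mP - mH u z) ^+ 2 <= gap_rate * D.
Proof.
apply: le_trans (perm_poincare l_gt0 gP gN u z) _.
have D0 := dirichlet_ge0.
have n3 : 0 <= 144 * n ^+ 3 * D.
  apply: mulr_ge0 => //; apply: mulr_ge0; first by rewrite ler0n.
  exact/exprn_ge0/ltW.
apply: (@le_trans _ _ ((3 * ln n) * (4 * (144 * n ^+ 3 * D)))); last first.
  by rewrite le_eqVlt; apply/orP; left; apply/eqP; rewrite /gap_rate; ring.
apply: (@le_trans _ _ ((\sum_(i < #|V1|) i.+1%:R^-1) * (4 * (144 * n ^+ 3 * D)))).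
  apply: ler_wpM2l; first by apply: sumr_ge0 => i _; rewrite invr_ge0.
  by rewrite ler_pM2l // min_energy_le.
apply: ler_wpM2r; first by rewrite mulr_ge0.
exact: harmonic_le.
Qed.

(** * Means over the classes and over the whole space *)

Definition perfect_prob : R := n ^+ 2 * A / Z.
Definition hole_prob u z : R := hole_mass u z / Z.
Let Eg := \sum_x mu x * g x.

Lemma weighted_sum (phi : {set V1 * V2} -> R) :
  \sum_x mu x * (phi (val x) * g x)
    = \sum_s piB lam w (pgraph b0 s) * (phi (pgraph b0 s) * gP s)
      + \sum_u \sum_s piB lam w (hgraph b0 s u) * (phi (hgraph b0 s u) * gN s u).
Proof.
(* Extends [g] to all edge sets so that sums over states can be rewritten over graphs; the default 0
   is taken only outside [Omega]. *)
pose G M := if insub M is Some x then g x else 0.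
have GE x : G (val x) = g x by rewrite /G valK.
transitivity (\sum_(x : state V1 V2) piB lam w (val x) * (phi (val x) * G (val x))).
  by apply: eq_bigr => x _; rewrite GE.
rewrite (state_sum (fun M => piB lam w M * (phi M * G M))); congr (_ + _).
  by apply: eq_bigr => s _; rewrite /gP -(GE (pstate s)).
by apply: eq_bigr => u _; apply: eq_bigr => s _; rewrite /gN -(GE (hstate s u)).
Qed.

Lemma perfect_part : \sum_s piB lam w (pgraph b0 s) * gP s = perfect_prob * mP.
Proof.
rewrite /perfect_prob /mP /perfect_mean -/W -/A.
transitivity (n ^+ 2 / Z * \sum_s W s * gP s); last by field; rewrite !lt0r_neq0 ?normalizer_gt0.
by rewrite mulr_sumr; apply: eq_bigr => s _; rewrite piB_pgraph; ring.
Qed.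

Lemma hole_part u z :
  \sum_(s : {perm V1} | s u == z) piB lam w (hgraph b0 s u) * gN s u = hole_prob u z * mH u z.
Proof.
rewrite /hole_prob /hole_mass /mH /hole_mean -/W -/(B u z).
transitivity (w u (b0 z) / l u z / Z * \sum_(s : {perm V1} | s u == z) W s * gN s u); last first.
  by field; rewrite !lt0r_neq0 ?normalizer_gt0.
by rewrite mulr_sumr; apply: eq_bigr => s /eqP e; rewrite piB_hgraph e; ring.
Qed.

Lemma total_mean : Eg = perfect_prob * mP + \sum_u \sum_z hole_prob u z * mH u z.
Proof.
have -> : Eg = \sum_x mu x * ((fun=> 1) (val x) * g x).
  by apply: eq_bigr => x _; rewrite mul1r.
rewrite (weighted_sum (fun=> 1)) -perfect_part; congr (_ + _).
  by apply: eq_bigr => s _; rewrite mul1r.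
apply: eq_bigr => u _; rewrite (sum_perm_by_image _ u); apply: eq_bigr => z _.
by rewrite -hole_part; apply: eq_bigr => s _; rewrite mul1r.
Qed.

Lemma total_prob : perfect_prob + \sum_u \sum_z hole_prob u z = 1.
Proof.
have Z0 := normalizer_gt0.
rewrite /perfect_prob /hole_prob.
under eq_bigr do rewrite -mulr_suml.
by rewrite -mulr_suml -mulrDl -normalizer_eq mulfV // lt0r_neq0.
Qed.

Lemma hole_prob_ge0 u z : 0 <= hole_prob u z.
Proof. by rewrite divr_ge0 // ltW ?normalizer_gt0 ?hole_mass_gt0. Qed.

Lemma perfect_prob_ge0 : 0 <= perfect_prob.
Proof. by rewrite divr_ge0 ?mulr_ge0 ?exprn_ge0 // ltW ?normalizer_gt0. Qed.

(** The overall mean minus [mP] is an average of the hole gaps with weights of total at most 1, so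
    Jensen transfers [hole_perfect_gap] with no loss. *)
Lemma mean_perfect_gap : (Eg - mP) ^+ 2 <= gap_rate * D.
Proof.
have -> : Eg - mP = \sum_(j : V1 * V1) hole_prob j.1 j.2 * (mH j.1 j.2 - mP).
  rewrite -(pair_bigA _ (fun u z => hole_prob u z * (mH u z - mP))) /=.
  have -> : \sum_u \sum_z hole_prob u z * (mH u z - mP) =
      \sum_u \sum_z hole_prob u z * mH u z - (\sum_u \sum_z hole_prob u z) * mP.
    rewrite mulr_suml -sumrB; apply: eq_bigr => u _.
    by rewrite mulr_suml -sumrB; apply: eq_bigr => z _; rewrite mulrBr.
  rewrite total_mean.
  have -> : \sum_u \sum_z hole_prob u z = 1 - perfect_prob by rewrite -total_prob addrC addKr.
  ring.
have sum1 : \sum_(j : V1 * V1) hole_prob j.1 j.2 <= 1.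
  rewrite -(pair_bigA _ (fun u z => hole_prob u z)) -total_prob lerDr.
  exact: perfect_prob_ge0.
have sum0 : 0 <= \sum_(j : V1 * V1) hole_prob j.1 j.2.
  by apply: sumr_ge0 => j _; exact: hole_prob_ge0.
have kD : 0 <= gap_rate * D by rewrite mulr_ge0 ?dirichlet_ge0 // ltW // gap_rate_gt0.
apply: (@le_trans _ _ ((\sum_(j : V1 * V1) hole_prob j.1 j.2) *
    (\sum_(j : V1 * V1) hole_prob j.1 j.2 * (mH j.1 j.2 - mP) ^+ 2))).
  apply: sqr_sum_le => j _; first exact: hole_prob_ge0.
    by rewrite mulr_ge0 ?sqr_ge0 // hole_prob_ge0.
  by rewrite exprMn expr2 -mulrA.
have hsum : \sum_(j : V1 * V1) hole_prob j.1 j.2 * (mH j.1 j.2 - mP) ^+ 2 <= gap_rate * D.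
  apply: (@le_trans _ _ ((\sum_(j : V1 * V1) hole_prob j.1 j.2) * (gap_rate * D))).
    rewrite mulr_suml; apply: ler_sum => j _; apply: ler_wpM2l; first exact: hole_prob_ge0.
    by rewrite -sqrrN opprB hole_perfect_gap.
  by rewrite ler_piMl.
apply: le_trans hsum; apply: ler_piMl => //; apply: sumr_ge0 => j _.
by rewrite mulr_ge0 ?sqr_ge0 // hole_prob_ge0.
Qed.

Lemma piB_set_state (S : {set {set V1 * V2}}) : (S \subset Omega)%SET ->
  \sum_x mu x * (val x \in S)%:R = piB_set lam w S.
Proof.
move=> /fintype.subsetP SO.
rewrite /piB_set -(big_sub (mem Omega) (fun M => piB lam w M * (M \in S)%:R)).
rewrite [LHS]big_mkcond [RHS]big_mkcond /=; apply: eq_bigr => M _.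
have [/SO|MS] := boolP (M \in S).
  by rewrite unfold_in /= => ->; rewrite mulr1.
by rewrite mulr0; case: ifP.
Qed.

Lemma class_mean (S : {set {set V1 * V2}}) :
  (S = perfect \/ exists u v, S = near_perfect u v) ->
  exists2 m, \sum_x mu x * ((val x \in S)%:R * g x) = piB_set lam w S * m
    & (m - mP) ^+ 2 <= gap_rate * D.
Proof.
have kD : 0 <= gap_rate * D by rewrite mulr_ge0 ?dirichlet_ge0 // ltW // gap_rate_gt0.
move=> [->|[u [v ->]]].
  exists mP; last by rewrite subrr expr0n.
  rewrite (weighted_sum (fun M => (M \in perfect)%:R)) [X in _ + X]big1 => [|u _].
    rewrite addr0 /piB_set (sum_perfect b0K b0'K).
    have -> : \sum_s piB lam w (pgraph b0 s) = perfect_prob.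
      rewrite /perfect_prob mulr_sumr mulr_suml; apply: eq_bigr => s _.
      by rewrite piB_pgraph.
    rewrite -perfect_part; apply: eq_bigr => s _.
    by rewrite (pgraph_perfect b0K b0'K) mul1r.
  by apply: big1 => s _; rewrite (negPf (hgraph_not_perfect _ _ _)) mul0r mulr0.
rewrite -(b0'K v); set z := b0' v.
exists (mH u z); last by rewrite -sqrrN opprB hole_perfect_gap.
rewrite (weighted_sum (fun M => (M \in near_perfect u (b0 z))%:R)) big1 => [|s _].
  rewrite add0r (bigD1 u) //= [X in _ + X]big1 => [|u' u'u]; last first.
    apply: big1 => s _.
    by rewrite (hgraph_near_perfectE b0K b0'K) eq_sym (negPf u'u) mul0r mulr0.
  rewrite addr0 /piB_set (sum_near_perfect b0K b0'K).
  have -> : \sum_(s : {perm V1} | b0 (s u) == b0 z) piB lam w (hgraph b0 s u)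
      = hole_prob u z.
    rewrite /hole_prob -sum_hole_mass mulr_suml; apply: eq_bigl => s.
    by rewrite (can_eq b0K).
  rewrite -hole_part [RHS]big_mkcond /=; apply: eq_bigr => s _.
  rewrite (hgraph_near_perfectE b0K b0'K) eqxx (can_eq b0K) eq_sym.
  by case: ifP => _; rewrite ?mul1r // mul0r mulr0.
case: (boolP (pgraph b0 s \in near_perfect u (b0 z))) => [h|_]; last by rewrite mul0r mulr0.
have [t _ e] := near_perfectP b0'K h.
by have := hgraph_not_perfect b0 t u; rewrite -e (pgraph_perfect b0K b0'K).
Qed.

(** The pairing factors as p_S (m - Eg), and this is where p_S^2 arises. Both means are compared
    with [mP], and (a - b)^2 <= 2 a^2 + 2 b^2 gives the 4. *)
Lemma class_poincare (S : {set {set V1 * V2}}) :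
  (S = perfect \/ exists u v, S = near_perfect u v) ->
  mudot mu (fun x => (val x \in S)%:R - piB_set lam w S) g ^+ 2
    <= (4 * gap_rate * piB_set lam w S ^+ 2) * D.
Proof.
move=> hS; have [m em hm] := class_mean hS.
have -> : mudot mu (fun x => (val x \in S)%:R - piB_set lam w S) g
   = piB_set lam w S * (m - Eg).
  rewrite mulrBr -em /mudot [X in _ - X]mulr_sumr -sumrB; apply: eq_bigr => x _; ring.
rewrite exprMn [leRHS]mulrAC [leRHS]mulrC; apply: ler_wpM2l; first exact: sqr_ge0.
have h := mean_perfect_gap.
have := sqr_ge0 ((m - mP) + (Eg - mP)).
have -> : (m - Eg) ^+ 2 = 2 * (m - mP) ^+ 2 + 2 * (Eg - mP) ^+ 2
    - ((m - mP) + (Eg - mP)) ^+ 2 by ring.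
lra.
Qed.

End BoostedChain.

Theorem lemma4 (R : realType) :
  exists C : R, 0 < C /\
    forall (n : nat) (V1 V2 : finType),
      (2 <= n)%N -> #|V1| = n -> #|V2| = n ->
    forall lam w : V1 -> V2 -> R,
      (forall u v, 0 < lam u v) ->
      (forall u v, 0 < w u v) ->
      rough lam w ->
    forall (d : measure_display) (W : measurableType d)
           (Pr : probability W R) (X : nat -> W -> state V1 V2),
      markov_chain (fun x => piB lam w (val x)) (jsvB lam w) Pr X ->
    forall S : {set {set V1 * V2}},
      (S = perfect \/ exists u v, S = near_perfect u v) ->
    forall T : nat, (1 <= T)%N ->
      ('V_Pr[fun om => (T%:R^-1 * \sum_(t < T) (val (X t om) \in S)%:R)%R]
        <= (C * n%:R ^+ 3 * ln n%:R / T%:R * piB_set lam w S ^+ 2)%:E)%E.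
Proof.
(* 24 = 6 * 4: the 6 of [sum2_autocov_le] and the 4 of [class_poincare]; 1728 is the constant of
   [gap_rate]. *)
exists (24 * 1728); split => [|n V1 V2 n2 cV1 cV2 lam w lam0 w0 w_rough d W Pr X chain S hS T T1].
  by apply: mulr_gt0; rewrite ltr0n.
have [b0 [b0' [b0K b0'K]]] := bijection_of_card (etrans cV1 (esym cV2)).
have V1_0 : (0 < #|V1|)%N by rewrite cV1 ltnW.
have V1_2 : (2 <= #|V1|)%N by rewrite cV1.
have mu0 := mu_gt0 b0K b0'K lam0 w0 V1_0.
have K0 x y : 0 <= jsvB lam w x y by apply: (markov_kernel_ge0 chain); exact: mu0.
have K1 := jsvB_sum1 lam w.
have Krev := jsvB_rev b0K b0'K lam0 w0 V1_0.
have mu1 := mu_sum1 b0K b0'K lam0 w0 V1_0.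
have SO : (S \subset Omega)%SET.
  apply/fintype.subsetP => M; case: hS => [->|[u [v ->]]] MS; rewrite inE ?MS //.
  by apply/orP; right; apply/bigcupP; exists u => //; apply/bigcupP; exists v.
have mS := piB_set_state lam w SO.
have pS0 : 0 <= 4 * gap_rate R V1 * piB_set lam w S ^+ 2.
  by rewrite mulr_ge0 ?sqr_ge0 // mulr_ge0 // ltW // gap_rate_gt0.
have := variance_average chain K1 Krev (fun x => (val x \in S)%:R) T1 mu1.
rewrite /= => ->; rewrite lee_fin mS.
have := sum2_autocov_le (fun x => ltW (mu0 x)) K0 K1 Krev pS0
  (fun g => class_poincare b0K b0'K lam0 w0 w_rough V1_0 K0 g V1_2 hS) T.
move=> H; have Tpos : 0 < T%:R :> R by rewrite ltr0n.
rewrite mulrC ler_pdivrMr ?exprn_gt0 //; apply: le_trans H _.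
rewrite le_eqVlt; apply/orP; left; apply/eqP; rewrite /gap_rate cV1; field.
exact: lt0r_neq0.
Qed.
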